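(* Let $\mathcal{B}$ be an injective unital C$^*$-algebra, let $J\subseteq\mathcal{B}$ be a (closed) two-sided ideal, and assume that $\mathcal{B}/J$ has a tracial state. If $\mathcal{A}$ is a unital C$^*$-algebra with no amenable trace, then any unital $*$-homomorphism from $\mathcal{A}$ into $\mathcal{B}/J$ fails to satisfy the local lifting property (LLP).
   Context: A tracial state $\tau$ on a C$^*$-algebra $\mathcal{A}\subseteq B(H)$ is called amenable (an amenable trace) if there is a state $\rho$ on $B(H)$ with $\rho|_{\mathcal{A}}=\tau$ and $\rho(aT)=\rho(Ta)$ for all $T\in B(H)$, $a\in\mathcal{A}$; this does not depend on the faithful representation of $\mathcal{A}$. A unital $*$-homomorphism $\pi:\mathcal{A}\to\mathcal{B}/J$ satisfies the LLP if for every finite-dimensional operator subsystem $\mathcal{T}\subseteq\mathcal{A}$ (a finite-dimensional self-adjoint subspace containing $1$) there is a unital completely positive (UCP) map $\psi:\mathcal{T}\to\mathcal{B}$ with $q\circ\psi=\pi|_{\mathcal{T}}$, where $q:\mathcal{B}\to\mathcal{B}/J$ is the quotient $*$-homomorphism. A unital C$^*$-algebra is injective if it is an injective object for operator systems and UCP maps (i.e. UCP maps into it extend from operator subsystems to larger operator systems). *)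

(* Defs.v *)
From HB Require Import structures.
Set Warnings "-notation-overridden,-ambiguous-paths".
Set Warnings "-notation-incompatible-prefix,-redundant-canonical-projection".
From mathcomp Require Import all_boot all_order all_algebra.
From mathcomp Require Import generic_quotient ring_quotient complex ring lra.
From mathcomp Require Import boolp classical_sets functions reals topology.
From mathcomp Require Import normedtype sequences.

Set Implicit Arguments.
Unset Strict Implicit.
Unset Printing Implicit Defensive.
Import Order.TTheory GRing.Theory Num.Theory.
Import numFieldNormedType.Exports.
Local Open Scope ring_scope.
Local Open Scope quotient_scope.

(* As algType requires 1 != 0, the zero algebra is excluded throughout. *)
HB.mixin Record isStarAlgebra (R : realType) A of GRing.Algebra R[i] A := {
  star : A -> A;
  starK : involutive star;
  starD : {morph star : x y / x + y};
  starZ : forall (c : R[i]) (x : A), star (c *: x) = c^* *: star x;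
  starM : forall x y : A, star (x * y) = star y * star x }.

#[short(type="starAlgType")]
HB.structure Definition StarAlgebra (R : realType) :=
  {A of GRing.Algebra R[i] A & isStarAlgebra R A}.

(* The norm is a field of the mixin, instead of being inherited from
   completeNormedModType, because Num.NumDomain is the only join of semirings
   and normed modules in the hierarchy and it forces commutativity.
   normc is the R-valued modulus. *)
HB.mixin Record isCStarAlgebra (R : realType) A of StarAlgebra R A := {
  cnorm : A -> R;
  cnormD : forall x y : A, cnorm (x + y) <= cnorm x + cnorm y;
  cnormZ : forall (c : R[i]) (x : A),
    cnorm (c *: x) = ComplexField.Normc.normc c * cnorm x;
  cnorm0_eq0 : forall x : A, cnorm x = 0 -> x = 0;
  cnormM : forall x y : A, cnorm (x * y) <= cnorm x * cnorm y;
  cnorm_star_mul : forall x : A, cnorm (star x * x) = cnorm x ^+ 2;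
  cnorm_complete : forall u : nat -> A,
    (forall e : R, 0 < e -> exists N, forall m n,
       (N <= m)%N -> (N <= n)%N -> cnorm (u m - u n) < e) ->
    exists l, forall e : R, 0 < e -> exists N, forall n,
       (N <= n)%N -> cnorm (u n - l) < e }.

#[short(type="cstarAlgType")]
HB.structure Definition CStarAlgebra (R : realType) :=
  {A of StarAlgebra R A & isCStarAlgebra R A}.

Section StarTheory.
Variables (R : realType) (A : starAlgType R).

Lemma star0 : star (0 : A) = 0.
Proof. by apply: (addrI (star (0 : A))); rewrite -starD !addr0. Qed.

Lemma starN (x : A) : star (- x) = - star x.
Proof. by apply: (addrI (star x)); rewrite -starD !subrr star0. Qed.

Lemma star1 : star (1 : A) = 1.
Proof. by rewrite -[LHS]mulr1 -[X in _ * X]starK -starM mulr1 starK. Qed.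

End StarTheory.

(* Closed under scaling since c *: x = c%:A * x. Properness is needed for B / J
   to be a (nonzero) algebra, and holds whenever B / J carries a state. *)
Record proper_closed_ideal (R : realType) (B : cstarAlgType R) :=
  ProperClosedIdeal {
  ideal_set :> B -> Prop;
  ideal0 : ideal_set 0;
  idealD : forall x y, ideal_set x -> ideal_set y -> ideal_set (x + y);
  idealMl : forall a x, ideal_set x -> ideal_set (a * x);
  idealMr : forall x a, ideal_set x -> ideal_set (x * a);
  ideal_closed : forall x,
    (forall e : R, 0 < e -> exists2 y, ideal_set y & cnorm (x - y) < e) ->
    ideal_set x;
  ideal_proper : ~ ideal_set 1 }.

Section CStarTheory.
Variables (R : realType) (A : cstarAlgType R).
Implicit Types (x y : A).

Lemma cnorm0 : cnorm (0 : A) = 0.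
Proof. by rewrite -(scale0r (0 : A)) cnormZ ComplexField.Normc.normc0 mul0r. Qed.

Lemma cnormN x : cnorm (- x) = cnorm x.
Proof.
rewrite -scaleN1r cnormZ (normcN (1 : Rcomplex R)).
by rewrite ComplexField.Normc.normc1 mul1r.
Qed.

Lemma cnorm_ge0 x : 0 <= cnorm x.
Proof. by have := cnormD x (- x); rewrite subrr cnorm0 cnormN; lra. Qed.

Lemma cnormB x y : cnorm (x - y) <= cnorm x + cnorm y.
Proof. by rewrite -(cnormN y) cnormD. Qed.

Lemma cnorm_sum (f : nat -> A) m n :
  cnorm (\sum_(m <= i < n) f i) <= \sum_(m <= i < n) cnorm (f i).
Proof.
elim/big_ind2: _ => [|x a y b xa yb|//]; first by rewrite cnorm0.
exact: le_trans (cnormD _ _) (lerD xa yb).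
Qed.

Lemma cnorm1 : cnorm (1 : A) = 1.
Proof.
have := cnorm_star_mul (1 : A); rewrite mulr1 star1 expr2 => h.
have n0 : cnorm (1 : A) != 0.
  by apply/eqP => /cnorm0_eq0/eqP; rewrite oner_eq0.
by apply: (mulfI n0); rewrite mulr1.
Qed.

Lemma cnorm_star x : cnorm (star x) = cnorm x.
Proof.
have le y : cnorm y <= cnorm (star y).
  have := cnormM (star y) y; rewrite cnorm_star_mul expr2.
  have [->|n0] := eqVneq (cnorm y) 0; first by rewrite cnorm_ge0.
  by rewrite ler_pM2r // lt_def n0 cnorm_ge0.
by apply/eqP; rewrite eq_le le andbT -{2}[x]starK le.
Qed.

Lemma cnormX x n : cnorm (x ^+ n) <= cnorm x ^+ n.
Proof.
elim: n => [|n ih]; first by rewrite !expr0 cnorm1.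
rewrite !exprS; apply: le_trans (cnormM _ _) _.
by rewrite ler_wpM2l ?cnorm_ge0.
Qed.

Lemma neumann x : cnorm x < 1 -> exists y, (1 - x) * y = 1 /\ y * (1 - x) = 1.
Proof.
move=> x1; set r := cnorm x.
have r0 : 0 <= r by exact: cnorm_ge0.
pose S n := \sum_(0 <= k < n) x ^+ k.
have rn e : 0 < e -> exists N, forall n, (N <= n)%N -> r ^+ n < e.
  move=> e0; have /cvgrPdist_lt/(_ _ e0) : (geometric 1 r @ \oo --> (0 : R))%classic.
    by apply: cvg_geometric; rewrite ger0_norm.
  case=> N _ h; exists N => n /h /=.
  by rewrite sub0r normrN mul1r ger0_norm // exprn_ge0.
have Sd m n : (m <= n)%N -> cnorm (S n - S m) * (1 - r) <= r ^+ m.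
  move=> mn; rewrite /S (big_cat_nat _ mn) //= addrAC subrr add0r.
  have : cnorm (\sum_(m <= i < n) x ^+ i) <= \sum_(m <= i < n) r ^+ i.
    by apply: le_trans (cnorm_sum _ _ _) _; apply: ler_sum => i _; exact: cnormX.
  rewrite -(@ler_pM2r _ (1 - r)) ?subr_gt0 //.
  move=> h; apply: le_trans h _.
  have -> : (\sum_(m <= i < n) r ^+ i) * (1 - r) = r ^+ m - r ^+ n.
    rewrite -(subnKC mn); elim: (n - m)%N => [|k ih].
      by rewrite addn0 big_geq // mul0r subrr.
    rewrite addnS big_nat_recr ?leq_addr //= mulrDl ih exprS; ring.
  by rewrite gerBl exprn_ge0.
have [|y yS] := cnorm_complete S.
  move=> e e0; have [|N hN] := rn (e * (1 - r)); first by rewrite mulr_gt0 ?subr_gt0.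
  exists N => m n.
  wlog mn : m n / (n <= m)%N.
    move=> H Nm Nn; have [/H|/ltnW/H] := leqP n m; first exact.
    by rewrite -cnormN opprB; exact.
  move=> Nm Nn; rewrite -(@ltr_pM2r _ (1 - r)) ?subr_gt0 //.
  exact: le_lt_trans (Sd _ _ mn) (hN _ Nn).
have small (z : A) : (forall e, 0 < e -> cnorm z < e) -> z = 0.
  move=> h; apply: cnorm0_eq0; apply/eqP; rewrite eq_le cnorm_ge0 andbT.
  by rewrite leNgt; apply/negP => z0; have := h _ z0; rewrite ltxx.
have xS n : x * S n = S n - 1 + x ^+ n.
  elim: n => [|n ih]; first by rewrite /S big_geq // mulr0 sub0r expr0 addNr.
  rewrite [S n.+1]/S big_nat_recr //= -/(S n) mulrDr ih -exprS.
  by congr (_ + _); rewrite addrAC.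
have Sx n : S n * x = x * S n.
  rewrite /S mulr_suml mulr_sumr; apply: eq_bigr => i _.
  by rewrite -exprS -exprSr.
have kS n : (1 - x) * S n = 1 - x ^+ n.
  by rewrite mulrBl mul1r xS opprD opprB addrA [S n + _]addrC subrK.
have kS' n : S n * (1 - x) = 1 - x ^+ n by rewrite mulrBr mulr1 Sx -kS mulrBl mul1r.
exists y; suff : (1 - x) * y - 1 = 0 /\ y * (1 - x) - 1 = 0.
  by move=> [/eqP + /eqP]; rewrite !subr_eq0 => /eqP -> /eqP ->.
have bnd e : 0 < e -> exists n, cnorm (S n - y) * cnorm (1 - x) + r ^+ n < e.
  move=> e0; have b0 : 0 < cnorm (1 - x) + 1 by rewrite ltr_wpDl ?cnorm_ge0.
  have [|N hN] := yS (e / 2 / (cnorm (1 - x) + 1)); first by rewrite !divr_gt0.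
  have [|M hM] := rn (e / 2); first by lra.
  exists (maxn N M); have h1 := hM _ (leq_maxr N M).
  have := hN _ (leq_maxl N M); rewrite (ltr_pdivlMr _ _ b0) mulrDr mulr1 => h2.
  rewrite [ltRHS]splitr; apply: ltrD => //.
  by apply: le_lt_trans h2; rewrite lerDl cnorm_ge0.
split; apply: small => e /bnd [n]; apply: le_lt_trans.
  have -> : (1 - x) * y - 1 = - ((1 - x) * (S n - y)) - x ^+ n.
    by rewrite mulrBr kS opprB opprB addrA addrAC addrK.
  apply: le_trans (cnormB _ _) _; rewrite cnormN mulrC; apply: lerD; last exact: cnormX.
  by rewrite mulrC; apply: le_trans (cnormM _ _) _; rewrite mulrC.
have -> : y * (1 - x) - 1 = - ((S n - y) * (1 - x)) - x ^+ n.
  by rewrite mulrBl kS' opprB opprB addrA addrAC addrK.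
by apply: le_trans (cnormB _ _) _; rewrite cnormN; apply: lerD; [exact: cnormM|exact: cnormX].
Qed.

End CStarTheory.

Section ImaginaryScalars.
Variable R : realType.
Lemma conjE (c : R[i]) : c^* = conjc c.
Proof. by []. Qed.
Lemma conj_im (e : R) : (Complex 0 e)^* = - Complex 0 e :> R[i].
Proof. by rewrite conjE /=; congr Complex; rewrite oppr0. Qed.
Lemma im_im (e f : R) : Complex 0 e * Complex 0 f = Complex (- (e * f)) 0 :> R[i].
Proof. by rewrite [LHS]/GRing.mul /= !mul0r !mulr0 sub0r addr0. Qed.
Lemma normc_im (e : R) : ComplexField.Normc.normc (Complex 0 e) = `|e|.
Proof. by rewrite /= expr0n add0r sqrtr_sqr. Qed.
Lemma normc_re (e : R) : ComplexField.Normc.normc (Complex e 0) = `|e|.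
Proof. by rewrite /= expr0n addr0 sqrtr_sqr. Qed.
End ImaginaryScalars.

Section IdealStar.
Variables (R : realType) (A : cstarAlgType R).
Implicit Types (x y : A).

Lemma star_scalar (c : R[i]) : star (c%:A : A) = c^* %:A.
Proof. by rewrite starZ star1. Qed.

Lemma star_mul_im (a : A) (e : R) : star a = a ->
  star (a + (Complex 0 e)%:A) * (a + (Complex 0 e)%:A) = a * a + (Complex (e * e) 0)%:A.
Proof.
move=> sa; rewrite starD sa star_scalar conj_im scaleNr mulrBl !mulrDr.
rewrite -!scalerAl !mul1r -!scalerAr !mulr1 scalerA im_im.
rewrite opprD addrA addrK -scaleNr; congr (_ + _ *: _).
by rewrite [LHS]/GRing.opp /= opprK oppr0.
Qed.

Lemma sa_unit (a : A) (e : R) : star a = a -> 0 < e ->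
  exists q, (a + (Complex 0 e)%:A) * q = 1 /\ q * (a + (Complex 0 e)%:A) = 1.
Proof.
move=> sa e0; set n := cnorm a.
pose s := n ^+ 2 / (2 * e); pose p := a - (Complex 0 s)%:A.
have s0 : 0 <= s by rewrite divr_ge0 ?sqr_ge0 ?mulr_ge0 // ltW.
have es0 : 0 < e + s by rewrite ltr_wpDr.
have np : cnorm p < e + s.
  have le : cnorm p ^+ 2 <= n ^+ 2 + s ^+ 2.
    have -> : p = a + (Complex 0 (- s))%:A.
      by rewrite /p -scaleNr; congr (_ + _ *: _); rewrite [LHS]/GRing.opp /= oppr0.
    rewrite -cnorm_star_mul star_mul_im //; apply: le_trans (cnormD _ _) _.
    rewrite cnormZ cnorm1 normc_re mulr1 mulrNN.
    rewrite -expr2 ger0_norm ?sqr_ge0 // lerD2r expr2; exact: cnormM.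
  rewrite -(@ltr_pXn2r _ 2) ?nnegrE ?cnorm_ge0 ?(ltW es0) //.
  apply: le_lt_trans le _; rewrite sqrrD.
  have -> : n ^+ 2 = 2 * (e * s).
    by rewrite /s; field; rewrite gt_eqF.
  by have := exprn_gt0 2 e0; lra.
pose y := (Complex 0 (e + s)^-1) *: p.
have ny : cnorm y < 1.
  rewrite cnormZ normc_im gtr0_norm ?invr_gt0 //.
  by rewrite mulrC ltr_pdivrMr // mul1r.
have [z [yz zy]] := neumann ny.
pose c : R[i] := Complex 0 (e + s).
have c0 : c != 0 by rewrite eq_complex /= negb_and (gt_eqF es0) orbT.
have pE : a + (Complex 0 e)%:A = c *: (1 - y).
  rewrite scalerBr /y scalerA im_im divff ?gt_eqF //.
  have -> : Complex (-1) 0 = -1 :> R[i] by rewrite [RHS]/GRing.opp /= oppr0.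
  rewrite scaleN1r opprK /p addrA addrAC -scalerBl [RHS]addrC.
  congr (_ + _ *: _); rewrite /c [RHS]/GRing.add /=.
  by rewrite oppr0 addr0 addrK.
exists (c^-1 *: z); rewrite pE.
by rewrite -!scalerAl -!scalerAr !scalerA divff ?mulVf ?scale1r ?yz ?zy.
Qed.

(* Closed two-sided ideals of a C*-algebra are self-adjoint: star x is the limit
   of star x * (a ^+ 2 / (a ^+ 2 + e ^+ 2)), a := x * star x, as e tends to 0. *)
Lemma ideal_star (J : proper_closed_ideal A) x : J x -> J (star x).
Proof.
move=> Jx; pose a := x * star x.
have sa : star a = a by rewrite starM starK.
have Ja : J a by exact: idealMr.
suff H (e : R) : 0 < e -> exists2 y, J y & cnorm (star x - y) ^+ 2 <= 2 * e.
  apply: ideal_closed => e e0.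
  have [|y Jy h] := H (e ^+ 2 / 4); first by rewrite divr_gt0 ?exprn_gt0.
  exists y => //; rewrite -(@ltr_pXn2r _ 2) ?nnegrE ?cnorm_ge0 ?(ltW e0) //.
  have e2 : 0 < e ^+ 2 by rewrite exprn_gt0.
  apply: le_lt_trans h _; lra.
move=> e0; pose i : R[i] := Complex 0 e; pose p : A := a + i%:A.
have [q [pq qp]] := sa_unit sa e0; rewrite -/p in pq qp.
have sp : star p = a - i%:A by rewrite starD sa star_scalar conj_im scaleNr.
have sp_p : star p = p - (i + i)%:A.
  by rewrite sp /p scalerDl opprD addrA addrK.
have psp : p * star p = star p * p.
  by rewrite sp_p mulrBl mulrBr -scalerAl -scalerAr mul1r mulr1.
have sq_sp : star q * star p = 1 by rewrite -starM pq star1.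
have sp_sq : star p * star q = 1 by rewrite -starM qp star1.
have spq : star p * q = q * star p.
  rewrite -[LHS]mul1r -qp -[LHS]mulrA [p * (_ * _)]mulrA psp -!mulrA pq mulr1 //.
have iq : cnorm (i *: q) <= 1.
  pose u := star p * q.
  have uE : u = 1 - (i + i) *: q.
    by rewrite /u sp_p mulrBl pq -scalerAl mul1r.
  have su : star u * u = 1.
    rewrite /u starM starK -mulrA [p * _]mulrA psp.
    by rewrite -[star p * p * q]mulrA pq mulr1 sq_sp.
  have u1 : cnorm u = 1.
    apply/eqP; rewrite -(@eqrXn2 _ 2) ?cnorm_ge0 //.
    by rewrite -cnorm_star_mul su cnorm1 expr1n.
  have := cnormB 1 u; rewrite {1}uE opprB addrC subrK u1 cnorm1 !cnormZ.
  have -> : i + i = Complex 0 (e + e) by rewrite [LHS]/GRing.add /= addr0.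
  by rewrite !normc_im !gtr0_norm ?addr_gt0 // mulrDl; lra.
have isq : cnorm (i *: star q) <= 1.
  by move: iq; rewrite !cnormZ cnorm_star.
have aq : cnorm (a * q) <= 2.
  have -> : a * q = 1 - i *: q.
    by rewrite -pq /p mulrDl -scalerAl mul1r addrK.
  by apply: le_trans (cnormB _ _) _; rewrite cnorm1; lra.
have ii : i * i = - (e * e)%:C%C by rewrite im_im [RHS]/GRing.opp /= oppr0.
pose w := (i *: q) * (i *: star q).
have wE : w = - ((e * e)%:C%C *: (q * star q)).
  by rewrite /w -scalerAl -scalerAr scalerA ii scaleNr.
have w1 : 1 + w = a * a * (q * star q).
  have h : 1 = (a * a + (e * e)%:C%C%:A) * (q * star q).
    by rewrite -star_mul_im // -/p -mulrA [p * _]mulrA pq mul1r sp_sq.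
  by rewrite {1}h wE mulrDl -scalerAl mul1r addrK.
exists (star x * (1 + w)).
  by rewrite w1; apply: idealMl; apply: idealMr; exact: idealMl.
rewrite mulrDr mulr1 opprD addNKr cnormN -cnorm_star_mul starM starK.
have sw : star w = w.
  rewrite wE starN starZ starM starK; congr (- (_ *: _)).
  by rewrite conjE /= oppr0.
have leM y z (b c : R) : cnorm y <= b -> cnorm z <= c -> cnorm (y * z) <= b * c.
  move=> yb zc; apply: le_trans (cnormM _ _) _.
  by apply: ler_pM => //; exact: cnorm_ge0.
have -> : star w * x * (star x * w) = w * (a * w) by rewrite sw /a !mulrA.
have -> : 2 * e = (1 * 1) * (e * (2 * 1)) by rewrite !mul1r mulr1 mulrC.
apply: (leM); first exact: (leM).
have -> : a * w = i *: ((a * q) * (i *: star q)).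
  by rewrite /w -scalerAl -scalerAr !mulrA.
by rewrite cnormZ normc_im gtr0_norm // ler_pM2l //; apply: (leM).
Qed.
End IdealStar.

Section Quotient.
Variables (R : realType) (B : cstarAlgType R) (J : proper_closed_ideal B).

Definition ideal_pred : {pred B} := [pred x | `[< J x >]].

Lemma ideal_predP x : reflect (J x) (x \in ideal_pred).
Proof. exact: asboolP. Qed.

Lemma ideal_pred_zmod : zmod_closed ideal_pred.
Proof.
split=> [|x y /ideal_predP Jx /ideal_predP Jy]; apply/ideal_predP.
  exact: ideal0.
by apply: idealD => //; rewrite -mulN1r; exact: idealMl.
Qed.
HB.instance Definition _ := GRing.isZmodClosed.Build B ideal_pred ideal_pred_zmod.

(* The notions below (states, unital *-homomorphisms, lifts along the quotient
   map) only involve the *-algebra structure of B / J, so that the quotient norm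
   is not constructed. *)
Definition quotient_alg : Type := Quotient.quot ideal_pred.
HB.instance Definition _ := GRing.Zmodule.on quotient_alg.

Definition quotient_proj : B -> quotient_alg := \pi_(Quotient.quot ideal_pred).
Local Notation q := quotient_proj.

Lemma quotient_projP x y : q x = q y <-> J (x - y).
Proof.
rewrite /quotient_proj; split=> [/eqP|h].
  by rewrite -Quotient.idealrBE => /ideal_predP.
by apply/eqP; rewrite -Quotient.idealrBE; apply/ideal_predP.
Qed.

Lemma quotient_proj_surj u : exists x, u = q x.
Proof.
by exists (repr (u : Quotient.quot ideal_pred)); rewrite /quotient_proj reprK.
Qed.

Let rep (u : quotient_alg) : B := repr (u : Quotient.quot ideal_pred).
Let repK u : q (rep u) = u. Proof. exact: reprK. Qed.
Let rep_q x : J (rep (q x) - x). Proof. exact/quotient_projP/repK. Qed.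

Lemma quotient_projD : {morph q : x y / x + y}.
Proof. by move=> x y; rewrite /quotient_proj raddfD. Qed.

Definition quotient_mul (u v : quotient_alg) := q (rep u * rep v).
Definition quotient_scale (c : R[i]) (u : quotient_alg) := q (c *: rep u).
Definition quotient_star (u : quotient_alg) := q (star (rep u)).

Lemma quotient_projM x y : quotient_mul (q x) (q y) = q (x * y).
Proof.
apply/quotient_projP.
have -> : rep (q x) * rep (q y) - x * y =
    (rep (q x) - x) * rep (q y) + x * (rep (q y) - y).
  by rewrite mulrBl mulrBr addrA subrK.
by apply: idealD; [apply: idealMr|apply: idealMl].
Qed.

Lemma quotient_projZ c x : quotient_scale c (q x) = q (c *: x).
Proof.
by apply/quotient_projP; rewrite -scalerBr -mulr_algl; exact: idealMl.
Qed.

Lemma quotient_proj_star x : quotient_star (q x) = q (star x).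
Proof.
by apply/quotient_projP; rewrite -starN -starD; apply: ideal_star.
Qed.

Local Ltac lift u := have [? ->] := quotient_proj_surj u.

Fact quotient_mulA : associative quotient_mul.
Proof.
move=> u v w; lift u; lift v; lift w.
by rewrite !quotient_projM mulrA.
Qed.
Fact quotient_mul1 : left_id (q 1) quotient_mul.
Proof. by move=> u; lift u; rewrite !quotient_projM mul1r. Qed.
Fact quotient_1mul : right_id (q 1) quotient_mul.
Proof. by move=> u; lift u; rewrite !quotient_projM mulr1. Qed.
Fact quotient_mulDl : left_distributive quotient_mul +%R.
Proof.
move=> u v w; lift u; lift v; lift w.
by rewrite -quotient_projD !quotient_projM mulrDl quotient_projD.
Qed.
Fact quotient_mulDr : right_distributive quotient_mul +%R.
Proof.
move=> u v w; lift u; lift v; lift w.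
by rewrite -quotient_projD !quotient_projM mulrDr quotient_projD.
Qed.
Fact quotient_oner_neq0 : q 1 != 0.
Proof.
apply/eqP => h; apply: (@ideal_proper _ _ J).
rewrite -[1]subr0; apply/quotient_projP; rewrite h.
by apply: (addrI (q 0)); rewrite -quotient_projD !addr0.
Qed.
HB.instance Definition _ := GRing.Zmodule_isNzRing.Build quotient_alg
  quotient_mulA quotient_mul1 quotient_1mul quotient_mulDl quotient_mulDr
  quotient_oner_neq0.

Fact quotient_scaleA a b u :
  quotient_scale a (quotient_scale b u) = quotient_scale (a * b) u.
Proof. by lift u; rewrite !quotient_projZ scalerA. Qed.
Fact quotient_scale1 : left_id 1 quotient_scale.
Proof. by move=> u; lift u; rewrite quotient_projZ scale1r. Qed.
Fact quotient_scaleDr : right_distributive quotient_scale +%R.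
Proof.
move=> c u v; lift u; lift v.
by rewrite -quotient_projD !quotient_projZ scalerDr quotient_projD.
Qed.
Fact quotient_scaleDl u : {morph quotient_scale^~ u : a b / a + b}.
Proof.
by move=> a b; lift u; rewrite !quotient_projZ scalerDl quotient_projD.
Qed.
HB.instance Definition _ := GRing.Zmodule_isLmodule.Build R[i] quotient_alg
  quotient_scaleA quotient_scale1 quotient_scaleDr quotient_scaleDl.

Fact quotient_scaleAl (c : R[i]) (u v : quotient_alg) : c *: (u * v) = c *: u * v.
Proof.
lift u; lift v; rewrite -![_ * _]/(quotient_mul _ _) -![_ *: _]/(quotient_scale _ _).
by rewrite !(quotient_projM, quotient_projZ) scalerAl.
Qed.
HB.instance Definition _ := GRing.Lmodule_isLalgebra.Build R[i] quotient_alg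
  quotient_scaleAl.
Fact quotient_scaleAr (c : R[i]) (u v : quotient_alg) : c *: (u * v) = u * (c *: v).
Proof.
lift u; lift v; rewrite -![_ * _]/(quotient_mul _ _) -![_ *: _]/(quotient_scale _ _).
by rewrite !(quotient_projM, quotient_projZ) scalerAr.
Qed.
HB.instance Definition _ := GRing.Lalgebra_isAlgebra.Build R[i] quotient_alg
  quotient_scaleAr.

Fact quotient_starK : involutive quotient_star.
Proof. by move=> u; lift u; rewrite !quotient_proj_star starK. Qed.
Fact quotient_starD : {morph quotient_star : u v / u + v}.
Proof.
move=> u v; lift u; lift v.
by rewrite -quotient_projD !quotient_proj_star starD quotient_projD.
Qed.
Fact quotient_starZ (c : R[i]) (u : quotient_alg) :
  quotient_star (c *: u) = c^* *: quotient_star u.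
Proof.
lift u; rewrite -![_ *: _]/(quotient_scale _ _).
by rewrite !(quotient_proj_star, quotient_projZ) starZ.
Qed.
Fact quotient_starM (u v : quotient_alg) :
  quotient_star (u * v) = quotient_star v * quotient_star u.
Proof.
lift u; lift v; rewrite -![_ * _]/(quotient_mul _ _).
by rewrite !(quotient_proj_star, quotient_projM) starM.
Qed.
HB.instance Definition _ := isStarAlgebra.Build R quotient_alg
  quotient_starK quotient_starD quotient_starZ quotient_starM.
End Quotient.

HB.mixin Record isStarMorphism (R : realType) (A B : starAlgType R) (f : A -> B) := {
  starmorph : {morph f : x / star x} }.
#[short(type="starHom")]
HB.structure Definition StarMorphism (R : realType) (A B : starAlgType R) :=
  {f of isStarMorphism R A B f & @GRing.LRMorphism R[i] A B *:%R f}.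

Section QuotientMorphism.
Variables (R : realType) (B : cstarAlgType R) (J : proper_closed_ideal B).
Fact quotient_proj_linear : linear (quotient_proj J).
Proof. by move=> c x y; rewrite quotient_projD -quotient_projZ. Qed.
Fact quotient_proj_monoid_morphism : monoid_morphism (quotient_proj J).
Proof. by split=> // x y; rewrite -quotient_projM. Qed.
HB.instance Definition _ := GRing.isLinear.Build R[i] B (quotient_alg J) *:%R
  (quotient_proj J) quotient_proj_linear.
HB.instance Definition _ := GRing.isMonoidMorphism.Build B (quotient_alg J)
  (quotient_proj J) quotient_proj_monoid_morphism.
Fact quotient_proj_starmorph : {morph quotient_proj J : x / star x}.
Proof. by move=> x; rewrite -quotient_proj_star. Qed.
HB.instance Definition _ := isStarMorphism.Build R B (quotient_alg J)
  (quotient_proj J) quotient_proj_starmorph.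
End QuotientMorphism.

(* The inner product is linear in the first variable. Nontriviality makes B(H) a
   nonzero algebra; nonzero unital algebras have no faithful unital
   representation on the zero space. *)
HB.mixin Record isHilbert (R : realType) H of CompleteNormedModule R[i] H := {
  dot : H -> H -> R[i];
  dotDl : forall x y z : H, dot (x + y) z = dot x z + dot y z;
  dotZl : forall (c : R[i]) (x y : H), dot (c *: x) y = c * dot x y;
  dot_conj : forall x y : H, dot y x = (dot x y)^*;
  dot_norm : forall x : H, dot x x = `|x| ^+ 2;
  hilbert_neq0 : exists x : H, x != 0 }.

#[short(type="hilbertType")]
HB.structure Definition Hilbert (R : realType) :=
  {H of CompleteNormedModule R[i] H & isHilbert R H}.

Section HilbertTheory.
Variables (R : realType) (H : hilbertType R).
Implicit Types (x y z : H).

Lemma dotDr x y z : dot x (y + z) = dot x y + dot x z.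
Proof. by rewrite dot_conj dotDl rmorphD /= -!dot_conj. Qed.

Lemma dotZr (c : R[i]) x y : dot x (c *: y) = c^* * dot x y.
Proof. by rewrite dot_conj dotZl rmorphM /= -dot_conj. Qed.

Lemma dotBr x y z : dot x (y - z) = dot x y - dot x z.
Proof. by rewrite dotDr -scaleN1r dotZr rmorphN1 mulN1r. Qed.

Let N x : R := complex.Re `|x|.
Let rd x y : R := complex.Re (dot x y).

Lemma ReD (a b : R[i]) : complex.Re (a + b) = complex.Re a + complex.Re b.
Proof. by case: a; case: b. Qed.

Lemma Re_le (a b : R[i]) : a <= b -> complex.Re a <= complex.Re b.
Proof. by case: a => a1 a2; case: b => b1 b2 /andP[]. Qed.

Lemma ReZ (t : R) (a : R[i]) : complex.Re (t%:C%C * a) = t * complex.Re a.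
Proof. by case: a => a1 a2; rewrite [_ * _]/GRing.mul /= mul0r subr0. Qed.

Lemma ge0_ReK (a : R[i]) : 0 <= a -> a = (complex.Re a)%:C%C.
Proof. by case: a => a1 a2 /andP[/= /eqP -> _]. Qed.

Let NE x : `|x| = (N x)%:C%C.
Proof. by rewrite /N -ge0_ReK. Qed.

Let N_ge0 x : 0 <= N x.
Proof. exact: Re_le (normr_ge0 x). Qed.

Let ND x y : N (x + y) <= N x + N y.
Proof. by rewrite -ReD; exact: Re_le (ler_normD x y). Qed.

Let rdxx x : rd x x = N x ^+ 2.
Proof. by rewrite /rd dot_norm NE -rmorphXn. Qed.

Let rdDl x y z : rd (x + y) z = rd x z + rd y z.
Proof. by rewrite /rd dotDl ReD. Qed.

Let rdC x y : rd x y = rd y x.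
Proof. by rewrite /rd dot_conj; case: (dot y x). Qed.

Let rdZl t x y : rd (t%:C%C *: x) y = t * rd x y.
Proof. by rewrite /rd dotZl ReZ. Qed.

Let rdDr x y z : rd x (y + z) = rd x y + rd x z.
Proof. by rewrite rdC rdDl !(rdC x). Qed.

Let rdZr t x y : rd x (t%:C%C *: y) = t * rd x y.
Proof. by rewrite rdC rdZl rdC. Qed.

Let N2D x y : N (x + y) ^+ 2 = N x ^+ 2 + 2 * rd x y + N y ^+ 2.
Proof. by rewrite -!rdxx rdDl !rdDr (rdC y x); ring. Qed.

Let rd_le x y : rd x y <= N x * N y.
Proof.
have : N (x + y) ^+ 2 <= (N x + N y) ^+ 2.
  by rewrite ler_pXn2r ?nnegrE ?addr_ge0.
by rewrite N2D sqrrD -mulr_natl; lra.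
Qed.

Lemma Re_dot_le x y :
  complex.Re (dot x y) <= complex.Re `|x| * complex.Re `|y|.
Proof. exact: rd_le. Qed.

Let NZ t x : 0 <= t -> N (t%:C%C *: x) = t * N x.
Proof.
by move=> t0; rewrite /N normrZ ger0_norm ?ReZ // lecE /= eqxx.
Qed.

Let N_complete (u : nat -> H) :
  (forall e : R, 0 < e -> exists M, forall m n,
     (M <= m)%N -> (M <= n)%N -> N (u m - u n) < e) ->
  exists l, forall e : R, 0 < e -> exists M, forall n,
     (M <= n)%N -> N (u n - l) < e.
Proof.
move=> hu; have : (cauchy (u @ \oo))%classic.
  apply: cauchy_exP => e e0.
  have eE := ge0_ReK (ltW e0); rewrite eE in e0 *.
  have [|M hM] := hu (complex.Re e); first by move: e0; rewrite ltcR.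
  exists (u M); exists M => // n /= Mn.
  by rewrite -ball_normE /= NE ltcR; exact: hM.
move=> /cauchy_cvg/cvg_ex[l /cvgrPdist_lt hl]; exists l => e e0.
have [|M _ hM] := hl e%:C%C; first by rewrite ltcR.
by exists M => n /hM /=; rewrite distrC NE ltcR.
Qed.

(* z minimizes x |-> `|x| ^+ 2 - 2 * Re (f x). *)
Lemma riesz (f : H -> R[i]) (M : R) :
  (forall (c : R[i]) x y, f (c *: x + y) = c * f x + f y) ->
  (forall x, complex.Re (f x) <= M * complex.Re `|x|) ->
  exists z, forall x, f x = dot x z.
Proof.
move=> fl fb; pose g x := complex.Re (f x).
have gl t x y : g (t%:C%C *: x + y) = t * g x + g y by rewrite /g fl ReD ReZ.
have gD x y : g (x + y) = g x + g y by have := gl 1 x y; rewrite rmorph1 scale1r mul1r.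
have g0 : g 0 = 0 by apply: (addrI (g 0)); rewrite -gD !addr0.
have gZ t x : g (t%:C%C *: x) = t * g x by rewrite -[_ *: _]addr0 gl g0 addr0.
have gM x : g x <= M * N x := fb x.
pose P x := N x ^+ 2 - 2 * g x.
have Plb x : - M ^+ 2 <= P x.
  have := gM x; have := sqr_ge0 (N x - M); rewrite /P sqrrB -mulr_natl; lra.
pose S := [set P x | x in [set: H]]%classic.
have Sinf : has_inf S.
  by split; [exists (P 0), 0|exists (- M ^+ 2) => _ [x _ <-]].
pose m := inf S.
have mP x : m <= P x by apply: ge_inf; [exact: Sinf.2|exists x].
have ex n : exists x, P x < m + n.+1%:R^-1.
  have n0 : 0 < n.+1%:R^-1 :> R by rewrite invr_gt0 ltr0n.
  have [_ [x _ <-] h] := inf_adherent n0 Sinf.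
  by exists x.
have [u hu] := choice ex.
have half x : x = (2^-1)%:C%C *: (x + x).
  rewrite -mulr2n -[X in _ *: X]scaler_nat scalerA.
  rewrite -(rmorph_nat (real_complex R)) -rmorphM mulVf ?pnatr_eq0 //.
  by rewrite scale1r.
have par x y : N (x - y) ^+ 2 <= 2 * (P x - m) + 2 * (P y - m).
  have := mP ((2^-1)%:C%C *: (x + y)).
  have rN : rd x (- y) = - rd x y.
    by have := rdZr (-1) x y; rewrite rmorphN1 scaleN1r mulN1r.
  have NN : N (- y) = N y by rewrite /N normrN.
  rewrite /P gZ gD NZ ?invr_ge0 // exprMn !N2D rN NN.
  move: (rd x y) (N x ^+ 2) (N y ^+ 2) (g x) (g y) => a b c d e.
  by rewrite expr2; lra.
have inv_small (e : R) : 0 < e -> exists K, forall n, (K <= n)%N -> n.+1%:R^-1 < e.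
  move=> e0; exists (Num.truncn e^-1) => n Kn.
  rewrite invf_plt ?posrE ?ltr0n //; apply: lt_le_trans (truncnS_gt _) _.
  by rewrite ler_nat ltnS.
have [|z hz] := N_complete (u := u).
  move=> e e0; have [|K hK] := inv_small (e ^+ 2 / 4).
    by rewrite divr_gt0 ?exprn_gt0.
  exists K => i j Ki Kj.
  rewrite -(@ltr_pXn2r _ 2) ?nnegrE ?N_ge0 ?(ltW e0) //.
  have Pm k : (K <= k)%N -> P (u k) - m < e ^+ 2 / 4.
    move=> Kk; rewrite ltrBlDl; apply: lt_trans (hu k) _.
    by rewrite ltrD2l; exact: hK.
  apply: le_lt_trans (par _ _) _; have := Pm _ Ki; have := Pm _ Kj.
  move: (P (u i) - m) (P (u j) - m) => a b; lra.
have zm : P z <= m.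
  apply/ler_addgt0Pr => e e0.
  pose c := 2 * N z + 3 + 2 * `|M|.
  have c0 : 0 < c.
    by rewrite /c; have := N_ge0 z; have := normr_ge0 M; lra.
  pose d := Num.min 1 (e / 2 / c).
  have d0 : 0 < d by rewrite lt_min ltr01 !divr_gt0.
  have [K1 hK1] := hz d d0.
  have [|K2 hK2] := inv_small (e / 2); first by rewrite divr_gt0.
  set n := maxn K1 K2.
  have h1 := hK1 n (leq_maxl _ _); have h2 := hK2 n (leq_maxr _ _).
  have h3 := hu n.
  pose w := z - u n.
  have Nw : N w < d by rewrite /w /N -normrN opprB.
  have zE : z = u n + w by rewrite /w addrC subrK.
  have uE : u n = z + - w by rewrite /w opprB addrC subrK.
  have Nu : N (u n) <= N z + 1.
    have NN : N (- w) = N w by rewrite /N normrN.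
    rewrite uE; apply: le_trans (ND _ _) _; rewrite NN lerD2l.
    by apply: ltW; apply: lt_le_trans Nw _; rewrite ge_min lexx.
  have gw : - g w <= `|M| * N w.
    have -> : - g w = g (- w).
      by have := gZ (-1) w; rewrite rmorphN1 scaleN1r mulN1r => ->.
    apply: le_trans (gM _) _; rewrite /N normrN; apply: ler_wpM2r.
      exact: N_ge0.
    exact: ler_norm.
  have Pz : P z = P (u n) + (2 * rd (u n) w + N w ^+ 2 - 2 * g w).
    by rewrite {1}zE /P N2D gD; ring.
  have rb : rd (u n) w <= (N z + 1) * N w.
    by apply: le_trans (rd_le _ _) _; apply: ler_wpM2r.
  have nb : N w ^+ 2 <= 1 * N w.
    rewrite expr2; apply: ler_wpM2r => //.
    by apply: ltW; apply: lt_le_trans Nw _; rewrite ge_min lexx.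
  have cb : c * N w <= e / 2.
    rewrite -ler_pdivlMl // mulrC; apply: ltW; apply: lt_le_trans Nw _.
    by rewrite ge_min lexx orbT.
  have h4 : P (u n) < m + e / 2 by apply: lt_trans h3 _; rewrite ltrD2l.
  rewrite Pz; rewrite /c in cb.
  move: (N z) `|M| (P (u n)) (rd _ _) (g w) (N w) cb nb rb gw h4.
  move=> a b a' b' c' v; lra.
have key h : rd h z = g h.
  have q (t : R) : 0 <= 2 * t * (rd h z - g h) + t ^+ 2 * N h ^+ 2.
    have := mP (z + t%:C%C *: h).
    rewrite /P N2D gD gZ rdZr -[N (_ *: _) ^+ 2]rdxx rdZl rdZr rdxx (rdC z h).
    by move: zm; rewrite /P; lra.
  set a := rd h z - g h in q; set b := N h ^+ 2 in q.
  suff : a = 0 by move/eqP; rewrite subr_eq0 => /eqP.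
  have b0 : 0 <= b by exact: sqr_ge0.
  have b1 : 0 < b + 1 by lra.
  apply/eqP; rewrite -sqrf_eq0 eq_le sqr_ge0 andbT.
  have := q (- a / (b + 1)).
  have -> : 2 * (- a / (b + 1)) * a + (- a / (b + 1)) ^+ 2 * b =
     - (a ^+ 2 * ((b + 2) / (b + 1) ^+ 2)).
    by field; rewrite gt_eqF.
  rewrite oppr_ge0 pmulr_lle0 // divr_gt0 ?exprn_gt0 //; lra.
exists z => x; apply/eqP; rewrite eq_complex.
have im (c : R[i]) : complex.Im c = - complex.Re (Complex 0 1 * c).
  by case: c => a b; rewrite [_ * _]/GRing.mul /= mul0r mul1r sub0r opprK.
have := key x; rewrite /rd /g => ->; rewrite eqxx /= !im -dotZl.
have -> : Complex 0 1 * f x = f (Complex 0 1 *: x).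
  have f0 : f 0 = 0.
    have := fl 1 0 0; rewrite scaler0 addr0 mul1r => h.
    by apply: (addrI (f 0)); rewrite -h addr0.
  by rewrite -[_ *: _]addr0 fl f0 addr0.
by have := key (Complex 0 1 *: x); rewrite /rd /g => ->.
Qed.
End HilbertTheory.

Record bounded_operator (R : realType) (H : hilbertType R) := BoundedOperator {
  bop_fun :> H -> H;
  bop_linear : linear bop_fun;
  bop_bounded : exists M : R, forall x, `|bop_fun x| <= M%:C%C * `|x| }.

Section BoundedOperators.
Variables (R : realType) (H : hilbertType R).
Local Notation B := (bounded_operator H).
Implicit Types (S T : B) (x y : H).

HB.instance Definition _ := gen_eqMixin B.
HB.instance Definition _ := gen_choiceMixin B.

Lemma bopP S T : (forall x, S x = T x) -> S = T.
Proof.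
case: S T => [f fl fb] [g gl gb] /= /funext fg; subst g.
by congr BoundedOperator; exact: Prop_irrelevance.
Qed.

Lemma bopD T x y : T (x + y) = T x + T y.
Proof. by have := bop_linear T 1 x y; rewrite !scale1r. Qed.

Lemma bop0 T : T 0 = 0.
Proof. by apply: (addrI (T 0)); rewrite -bopD !addr0. Qed.

Lemma bopZ T (c : R[i]) x : T (c *: x) = c *: T x.
Proof. by rewrite -[c *: x]addr0 bop_linear bop0 addr0. Qed.

Lemma bopB T x y : T (x - y) = T x - T y.
Proof. by rewrite bopD -scaleN1r bopZ scaleN1r. Qed.

Lemma bop_bound_ge0 T :
  exists2 M : R, 0 <= M & forall x, `|T x| <= M%:C%C * `|x|.
Proof.
have [M hM] := bop_bounded T; exists `|M| => // x.
apply: le_trans (hM x) _; apply: ler_wpM2r => //.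
by rewrite lecR ler_norm.
Qed.

Fact bop_zero_lin : linear (fun _ : H => 0 : H).
Proof. by move=> c x y; rewrite scaler0 addr0. Qed.
Fact bop_zero_bdd : exists M : R, forall x : H, `|0 : H| <= M%:C%C * `|x|.
Proof. by exists 0 => x; rewrite normr0 mul0r. Qed.
Definition bop_zero : B := BoundedOperator bop_zero_lin bop_zero_bdd.

Fact bop_scale_lin (c : R[i]) T : linear (fun x => c *: T x).
Proof.
by move=> d x y; rewrite bop_linear scalerDr !scalerA mulrC.
Qed.
Fact bop_scale_bdd (c : R[i]) T :
  exists M : R, forall x, `|c *: T x| <= M%:C%C * `|x|.
Proof.
have [M hM] := bop_bounded T; exists (complex.Re `|c| * M) => x.
have cE := ge0_ReK (normr_ge0 c).
by rewrite normrZ {1}cE rmorphM -mulrA; apply: ler_wpM2l; rewrite // -cE.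
Qed.
Definition bop_scale c T : B :=
  BoundedOperator (bop_scale_lin c T) (bop_scale_bdd c T).

Fact bop_add_lin S T : linear (fun x => S x + T x).
Proof. by move=> c x y; rewrite !bop_linear scalerDr addrACA. Qed.
Fact bop_add_bdd S T : exists M : R, forall x, `|S x + T x| <= M%:C%C * `|x|.
Proof.
have [M hM] := bop_bounded S; have [M' hM'] := bop_bounded T.
exists (M + M') => x; apply: le_trans (ler_normD _ _) _.
by rewrite rmorphD mulrDl; exact: lerD.
Qed.
Definition bop_add S T : B :=
  BoundedOperator (bop_add_lin S T) (bop_add_bdd S T).
Definition bop_opp T : B := bop_scale (-1) T.

Fact bop_one_lin : linear (fun x : H => x).
Proof. by []. Qed.
Fact bop_one_bdd : exists M : R, forall x : H, `|x| <= M%:C%C * `|x|.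
Proof. by exists 1 => x; rewrite mul1r. Qed.
Definition bop_one : B := BoundedOperator bop_one_lin bop_one_bdd.

Fact bop_comp_lin S T : linear (fun x => S (T x)).
Proof. by move=> c x y; rewrite !bop_linear. Qed.
Fact bop_comp_bdd S T : exists M : R, forall x, `|S (T x)| <= M%:C%C * `|x|.
Proof.
have [M M0 hM] := bop_bound_ge0 S; have [M' hM'] := bop_bounded T.
exists (M * M') => x; apply: le_trans (hM _) _.
by rewrite rmorphM -mulrA ler_wpM2l // lecR.
Qed.
Definition bop_comp S T : B :=
  BoundedOperator (bop_comp_lin S T) (bop_comp_bdd S T).

Fact bop_addA : associative bop_add.
Proof. by move=> S T U; apply: bopP => x /=; rewrite addrA. Qed.
Fact bop_addC : commutative bop_add.
Proof. by move=> S T; apply: bopP => x /=; rewrite addrC. Qed.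
Fact bop_add0 : left_id bop_zero bop_add.
Proof. by move=> T; apply: bopP => x /=; rewrite add0r. Qed.
Fact bop_addN : left_inverse bop_zero bop_opp bop_add.
Proof. by move=> T; apply: bopP => x /=; rewrite scaleN1r addNr. Qed.
HB.instance Definition _ :=
  GRing.isZmodule.Build B bop_addA bop_addC bop_add0 bop_addN.

Fact bop_scaleA (a b : R[i]) T :
  bop_scale a (bop_scale b T) = bop_scale (a * b) T.
Proof. by apply: bopP => x /=; rewrite scalerA. Qed.
Fact bop_scale1 : left_id 1 bop_scale.
Proof. by move=> T; apply: bopP => x /=; rewrite scale1r. Qed.
Fact bop_scaleDr : right_distributive bop_scale +%R.
Proof. by move=> c S T; apply: bopP => x /=; rewrite scalerDr. Qed.
Fact bop_scaleDl T : {morph bop_scale^~ T : a b / a + b}.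
Proof. by move=> a b; apply: bopP => x /=; rewrite scalerDl. Qed.
HB.instance Definition _ := GRing.Zmodule_isLmodule.Build R[i] B
  bop_scaleA bop_scale1 bop_scaleDr bop_scaleDl.

Fact bop_compA : associative bop_comp.
Proof. by move=> S T U; apply: bopP. Qed.
Fact bop_1comp : left_id bop_one bop_comp.
Proof. by move=> T; apply: bopP. Qed.
Fact bop_comp1 : right_id bop_one bop_comp.
Proof. by move=> T; apply: bopP. Qed.
Fact bop_compDl : left_distributive bop_comp +%R.
Proof. by move=> S T U; apply: bopP. Qed.
Fact bop_compDr : right_distributive bop_comp +%R.
Proof. by move=> S T U; apply: bopP => x /=; rewrite bopD. Qed.
Fact bop_one_neq0 : bop_one != 0.
Proof.
have [x /eqP x0] := @hilbert_neq0 R H; apply/eqP => h; apply: x0.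
by rewrite -[LHS]/(bop_one x) h.
Qed.
HB.instance Definition _ := GRing.Zmodule_isNzRing.Build B
  bop_compA bop_1comp bop_comp1 bop_compDl bop_compDr bop_one_neq0.

Fact bop_scaleAl (c : R[i]) S T : c *: (S * T) = c *: S * T.
Proof. by apply: bopP. Qed.
HB.instance Definition _ := GRing.Lmodule_isLalgebra.Build R[i] B bop_scaleAl.
Fact bop_scaleAr (c : R[i]) S T : c *: (S * T) = S * (c *: T).
Proof. by apply: bopP => x; rewrite -[RHS]/(S (c *: T x)) bopZ. Qed.
HB.instance Definition _ := GRing.Lalgebra_isAlgebra.Build R[i] B bop_scaleAr.

Lemma adjoint_exists T y : exists z, forall x, dot (T x) y = dot x z.
Proof.
have [M M0 hM] := bop_bound_ge0 T.
apply: (@riesz _ _ (fun x => dot (T x) y) (M * complex.Re `|y|)).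
  by move=> c x x'; rewrite bop_linear dotDl dotZl.
move=> x; apply: le_trans (Re_dot_le _ _) _.
rewrite mulrAC; apply: ler_wpM2r; first exact: Re_le (normr_ge0 _).
by rewrite -ReZ; exact/Re_le/hM.
Qed.

Definition adjoint_fun T y : H := projT1 (cid (adjoint_exists T y)).

Lemma adjoint_funE T x y : dot (T x) y = dot x (adjoint_fun T y).
Proof. exact: (projT2 (cid (adjoint_exists T y)) x). Qed.

Lemma dot_inj y z : (forall x, dot x y = dot x z) -> y = z.
Proof.
move=> h; apply/eqP; rewrite -subr_eq0 -normr_eq0 -sqrf_eq0 -dot_norm.
by rewrite dotBr h subrr.
Qed.

Fact adjoint_lin T : linear (adjoint_fun T).
Proof.
move=> c y z; apply: dot_inj => x.
by rewrite -adjoint_funE dotDr dotZr dotDr dotZr -!adjoint_funE.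
Qed.
Fact adjoint_bdd T :
  exists M : R, forall y, `|adjoint_fun T y| <= M%:C%C * `|y|.
Proof.
have [M M0 hM] := bop_bound_ge0 T; exists M => y.
set z := adjoint_fun T y.
have [->|z0] := eqVneq `|z| 0; first by rewrite mulr_ge0 // lecR.
have zp : 0 < complex.Re `|z| by rewrite -ltcR -ge0_ReK // lt_def z0 normr_ge0.
rewrite [X in X <= _]ge0_ReK // [`|y|]ge0_ReK // -rmorphM lecR.
rewrite -(ler_pM2l zp).
have -> : complex.Re `|z| * complex.Re `|z| = complex.Re (dot (T z) y).
  by rewrite adjoint_funE dot_norm -/z -ReZ -(ge0_ReK (normr_ge0 z)) expr2.
apply: le_trans (Re_dot_le _ _) _.
rewrite mulrA; apply: ler_wpM2r; first exact: Re_le (normr_ge0 _).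
by rewrite mulrC -ReZ; exact/Re_le/hM.
Qed.
Definition adjoint T : B := BoundedOperator (adjoint_lin T) (adjoint_bdd T).

Lemma adjointE T x y : dot (T x) y = dot x (adjoint T y).
Proof. exact: adjoint_funE. Qed.

Lemma adjointEl T x y : dot (adjoint T x) y = dot x (T y).
Proof. by rewrite dot_conj -adjointE -dot_conj. Qed.

Fact adjointK : involutive adjoint.
Proof.
by move=> T; apply: bopP => y; apply: dot_inj => x; rewrite -adjointE adjointEl.
Qed.
Fact adjointD : {morph adjoint : S T / S + T}.
Proof.
move=> S T; apply: bopP => y; apply: dot_inj => x.
by rewrite -adjointE /= dotDl dotDr !adjointE.
Qed.
Fact adjointZ (c : R[i]) T : adjoint (c *: T) = c^* *: adjoint T.
Proof.
apply: bopP => y; apply: dot_inj => x.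
by rewrite -adjointE /= dotZl dotZr adjointE conjCK.
Qed.
Fact adjointM S T : adjoint (S * T) = adjoint T * adjoint S.
Proof.
apply: bopP => y; apply: dot_inj => x.
by rewrite -adjointE -[RHS]/(dot x (adjoint T (adjoint S y))) -!adjointE.
Qed.
HB.instance Definition _ := isStarAlgebra.Build R B
  adjointK adjointD adjointZ adjointM.
End BoundedOperators.

Section States.
Variables (R : realType) (A : starAlgType R).

(* On a unital C*-algebra, a positive functional f has norm f 1. *)
Record is_state (f : A -> R[i]) : Prop := IsState {
  state_linear : scalar f;
  state_ge0 : forall x, 0 <= f (star x * x);
  state1 : f 1 = 1 }.

Record tracial_state (tau : A -> R[i]) : Prop := TracialState {
  tracial_is_state : is_state tau;
  tracialC : forall x y, tau (x * y) = tau (y * x) }.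

End States.

Definition amenable_in (R : realType) (A : cstarAlgType R) (H : hilbertType R)
    (iota : starHom A (bounded_operator H)) (tau : A -> R[i]) : Prop :=
  exists rho : bounded_operator H -> R[i],
    [/\ is_state rho,
        forall a, rho (iota a) = tau a &
        forall a T, rho (iota a * T) = rho (T * iota a)].

(* The condition does not depend on the faithful representation, and faithful
   representations exist (Gelfand-Naimark). *)
Definition amenable_trace (R : realType) (A : cstarAlgType R)
    (tau : A -> R[i]) : Prop :=
  tracial_state tau /\
  forall (H : hilbertType R) (iota : starHom A (bounded_operator H)),
    injective iota -> amenable_in iota tau.

Section OperatorSystems.
Variables (R : realType) (A : starAlgType R).

(* Subspaces of A are not required to be closed. *)
Record operator_system (S : set A) : Prop := OperatorSystem {
  opsys1 : S 1;
  opsys_linear : forall (c : R[i]) x y, S x -> S y -> S (c *: x + y);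
  opsys_star : forall x, S x -> S (star x) }.

Definition finite_dimensional (S : set A) : Prop :=
  exists n (v : 'I_n -> A), forall x,
    S x <-> exists c : 'I_n -> R[i], x = \sum_i c i *: v i.

Definition star_mx n (X : 'M[A]_n) : 'M[A]_n := \matrix_(i, j) star (X j i).

Definition mx_positive n (X : 'M[A]_n) : Prop :=
  exists Y : 'M[A]_n, X = star_mx Y *m Y.

End OperatorSystems.

(* A map S -> B is represented by a function A -> B, whose values outside of S
   are irrelevant. *)
Record ucp_on (R : realType) (A B : starAlgType R) (S : set A) (phi : A -> B) :
  Prop := UcpOn {
  ucp_linear : forall (c : R[i]) x y, S x -> S y ->
    phi (c *: x + y) = c *: phi x + phi y;
  ucp1 : phi 1 = 1;
  ucp_positive : forall n (X : 'M[A]_n), (forall i j, S (X i j)) ->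
    mx_positive X -> mx_positive (map_mx phi X) }.

Definition injective_cstar (R : realType) (B : cstarAlgType R) : Prop :=
  forall (D : cstarAlgType R) (S1 S2 : set D),
    operator_system S1 -> operator_system S2 -> (forall x, S1 x -> S2 x) ->
  forall phi : D -> B, ucp_on S1 phi ->
  exists2 psi : D -> B, ucp_on S2 psi & forall x, S1 x -> psi x = phi x.

Definition LLP (R : realType) (A B : cstarAlgType R) (J : proper_closed_ideal B)
    (pi : A -> quotient_alg J) : Prop :=
  forall T : set A, operator_system T -> finite_dimensional T ->
  exists2 psi : A -> B, ucp_on T psi &
    forall x, T x -> quotient_proj J (psi x) = pi x.

(* Main.v *)
(* Let tr be a tracial state on B / J. If pi satisfied the LLP, then tr o pi would be
   amenable. Represent A faithfully on H and let T be the span of 1 and of the a, a^*,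
   a^* a, a a^* for a in a finite subset s of A. A UCP lift T -> B of pi extends, B being
   injective, to a UCP map Psi : B(H) -> B. The elements of s lie in the multiplicative
   domain of Phi := q o Psi, so that the state tr o Phi of B(H) satisfies
   tr (Phi (a x)) = tr (pi a * Phi x) = tr (Phi x * pi a) = tr (Phi (x a)) for a in s.
   A limit of these states along an ultrafilter on the finite subsets s is a state
   witnessing the amenability of tr o pi.

   For the injectivity of B to apply, the lift has to be UCP on the image of T in B(H),
   i.e. matrices over A that become positive over B(H) must be positive over A. This
   rests on square roots in C*-algebras, obtained without spectral theory. *)
From HB Require Import structures.
Require Import Defs.
Set Warnings "-notation-overridden,-ambiguous-paths".
Set Warnings "-notation-incompatible-prefix,-redundant-canonical-projection".
From mathcomp Require Import all_boot all_order all_algebra complex ring lra.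
From mathcomp Require Import boolp classical_sets functions reals topology.
From mathcomp Require Import normedtype sequences.
Set Implicit Arguments.
Unset Strict Implicit.
Unset Printing Implicit Defensive.
Import Order.TTheory GRing.Theory Num.Theory.
Import numFieldNormedType.Exports.
Local Open Scope ring_scope.

(** * Sesquilinear forms and square roots *)

Section Complex.
Variable R : realType.
Implicit Types (a b c : R[i]) (t : R).
Local Notation Re := complex.Re.
Local Notation Im := complex.Im.
Local Notation normc := ComplexField.Normc.normc.

Lemma ImD a b : Im (a + b) = Im a + Im b.
Proof. by case: a; case: b. Qed.

Lemma ReN a : Re (- a) = - Re a.
Proof. by case: a. Qed.

Lemma ReB a b : Re (a - b) = Re a - Re b.
Proof. by rewrite ReD ReN. Qed.

Lemma ReM a b : Re (a * b) = Re a * Re b - Im a * Im b.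
Proof. by case: a; case: b. Qed.

Lemma ImM a b : Im (a * b) = Re a * Im b + Im a * Re b.
Proof. by case: a => ? ?; case: b. Qed.

Lemma Re_conj a : Re a^* = Re a.
Proof. by case: a. Qed.

Lemma Im_conj a : Im a^* = - Im a.
Proof. by case: a. Qed.

Lemma ge0_Re a : 0 <= a -> 0 <= Re a.
Proof. by rewrite lecE => /andP[]. Qed.

Lemma mulcJ c : c * c^* = (normc c ^+ 2)%:C%C.
Proof.
case: c => x y; rewrite /= sqr_sqrtr ?addr_ge0 ?sqr_ge0 //.
rewrite conjE; apply/eqP; rewrite eq_complex /=; apply/andP; split; apply/eqP; ring.
Qed.

Lemma normc_nonneg c : 0 <= normc c.
Proof. by case: c => x y; exact: sqrtr_ge0. Qed.

Lemma le_Re_normc c : `|Re c| <= normc c.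
Proof. by case: c => x y; rewrite -sqrtr_sqr /= ler_wsqrtr // lerDl sqr_ge0. Qed.

Lemma le_Im_normc c : `|Im c| <= normc c.
Proof. by case: c => x y; rewrite -sqrtr_sqr /= ler_wsqrtr // lerDr sqr_ge0. Qed.

(** Discriminant bound with no sign assumed on the leading coefficient: [z < 0] is excluded by a
    large [t], [z = 0] forces [y = 0], and otherwise [t = - y / z] is the minimizer. *)
Lemma discr_le0 (x y z : R) :
  (forall t, 0 <= x + 2 * t * y + t ^+ 2 * z) -> y ^+ 2 <= x * z.
Proof.
move=> h; have x0 := h 0; rewrite mulr0 mul0r expr0n mul0r !addr0 in x0.
have z0 : 0 <= z.
  rewrite leNgt; apply/negP => zn.
  have := h 1; have := h (-1); rewrite !expr2 => h1 h2.
  (* Adding the values at [t] and [- t] removes the linear term. With [t = (x + 1) / - z], which is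
     at least 1 because [x + z >= 0], what remains is [x - t * (x + 1) <= -1]. *)
  have xz : 0 <= x + z by lra.
  pose t := (x + 1) / - z; have tn : 0 < - z by lra.
  have t1 : t * - z = x + 1 by rewrite /t divfK // gt_eqF.
  have t2 : 1 <= t by rewrite /t ler_pdivlMr //; lra.
  have := h t; have := h (- t); rewrite sqrrN => h3 h4.
  have : 0 <= x + t ^+ 2 * z by lra.
  have -> : t ^+ 2 * z = - t * (x + 1) by rewrite -t1; ring.
  by nra.
have [ze|zn] := eqVneq z 0.
  rewrite ze mulr0; have [->|yn] := eqVneq y 0; first by rewrite expr0n.
  have := h (- (x + 1) / (2 * y)); rewrite ze mulr0 addr0.
  have -> : 2 * (- (x + 1) / (2 * y)) * y = - (x + 1) by field.
  lra.
have zp : 0 < z by rewrite lt_def zn.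
have := h (- y / z).
have -> : x + 2 * (- y / z) * y + (- y / z) ^+ 2 * z = (x * z - y ^+ 2) / z by field.
by rewrite pmulr_lge0 ?invr_gt0 // subr_ge0.
Qed.

End Complex.

Section Forms.
Variables (R : realType) (V : lmodType R[i]) (f : V -> V -> R[i]).
Hypothesis f_linear : forall w, scalar (f^~ w).
Hypothesis fDr : forall u v w, f u (v + w) = f u v + f u w.
Hypothesis fZr : forall c u v, f u (c *: v) = c^* * f u v.
Hypothesis f_ge0 : forall v, 0 <= f v v.
Local Notation Re := complex.Re.
Local Notation Im := complex.Im.
Local Notation normc := ComplexField.Normc.normc.

Let fDl u v w : f (u + v) w = f u w + f v w.
Proof. by have := f_linear w 1 u v; rewrite scale1r mul1r. Qed.

Let f0l w : f 0 w = 0.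
Proof. by apply: (addrI (f 0 w)); rewrite -fDl !addr0. Qed.

Let fZl c u w : f (c *: u) w = c * f u w.
Proof. by have := f_linear w c u 0; rewrite !addr0 f0l addr0. Qed.

Let Im_f v : Im (f v v) = 0.
Proof. by have := f_ge0 v; rewrite lecE => /andP[/eqP]. Qed.

(** Polarization: hermitian symmetry follows from positivity, since the values of [f] on the
    diagonal at [u + v] and at [u + i v] are real. *)
Lemma form_conj u v : f v u = (f u v)^*.
Proof.
have h1 := Im_f (u + v); have h2 := Im_f (u + 'i%C *: v).
rewrite fDl !fDr !ImD !Im_f in h1; rewrite fDl !fDr !fZl !fZr !ImD !Im_f in h2.
rewrite !(ImM, Im_conj, Re_conj, ReM, Im_f) /= in h2.
by apply/eqP; rewrite eq_complex Re_conj Im_conj; apply/andP; split; apply/eqP; lra.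
Qed.

Lemma form_CS_Re u v : Re (f u v) ^+ 2 <= Re (f u u) * Re (f v v).
Proof.
apply: discr_le0 => t; have := ge0_Re (f_ge0 (u + t%:C%C *: v)).
rewrite fDl !fDr !fZl !fZr (form_conj u v) !(ReD, ReM, Re_conj, Im_conj) /=.
by move: (f u u) (f v v) (f u v) => [a1 a2] [b1 b2] [c1 c2] /=; lra.
Qed.

(** Multiplying [u] by the conjugate of [f u v] makes the pairing with [v] real, equal to
    [normc (f u v) ^+ 2]; the bound on real parts applies, and one such factor cancels. *)
Lemma form_CS u v : normc (f u v) ^+ 2 <= Re (f u u) * Re (f v v).
Proof.
have [->|n0] := eqVneq (normc (f u v)) 0.
  by rewrite expr0n mulr_ge0 ?ge0_Re.
have p : 0 < normc (f u v) ^+ 2 by rewrite exprn_gt0 // lt_def n0 normc_nonneg.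
have := form_CS_Re ((f u v)^* *: u) v; rewrite fZl mulrC mulcJ /= fZl fZr.
rewrite conjCK mulrA [_^* * _]mulrC mulcJ ReZ -mulrA [X in X <= _]expr2.
by rewrite ler_pM2l.
Qed.

Definition form_norm v : R := Num.sqrt (Re (f v v)).

Lemma form_norm_ge0 v : 0 <= form_norm v.
Proof. exact: sqrtr_ge0. Qed.

Lemma form_norm_sqr v : form_norm v ^+ 2 = Re (f v v).
Proof. by rewrite sqr_sqrtr // ge0_Re. Qed.

Lemma form_norm_CS u v : Re (f u v) <= form_norm u * form_norm v.
Proof.
apply: le_trans (ler_norm _) _; rewrite -sqrtrM ?ge0_Re // -sqrtr_sqr.
by rewrite ler_wsqrtr // form_CS_Re.
Qed.

Lemma form_normD u v : form_norm (u + v) <= form_norm u + form_norm v.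
Proof.
rewrite -(@ler_pXn2r _ 2) ?nnegrE ?addr_ge0 ?form_norm_ge0 // sqrrD !form_norm_sqr.
rewrite fDl !fDr (form_conj u v) !ReD Re_conj; have := form_norm_CS u v.
by move: (form_norm u * form_norm v) => ?; rewrite mulr2n; lra.
Qed.

Lemma form_normZ c v : form_norm (c *: v) = normc c * form_norm v.
Proof.
rewrite /form_norm fZl fZr mulrA mulcJ ReZ sqrtrM ?sqr_ge0 //.
by rewrite sqrtr_sqr ger0_norm ?normc_nonneg.
Qed.

Lemma form_norm0_eq0 v : form_norm v = 0 -> f v v = 0.
Proof.
by move=> h; rewrite [f v v]ge0_ReK // -form_norm_sqr h expr0n.
Qed.

End Forms.

Section SquareRoots.
Variables (R : realType) (A : cstarAlgType R).
Implicit Types (x y z : A).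

Lemma cnorm_small C z : (forall e : R, 0 < e -> cnorm z <= C * e) -> z = 0.
Proof.
move=> h; apply: cnorm0_eq0; apply/eqP; rewrite eq_le cnorm_ge0 andbT.
have C0 : 0 <= C by have := le_trans (cnorm_ge0 _) (h 1 ltr01); rewrite mulr1.
apply/ler_addgt0Pr => e e0; rewrite add0r.
have C1 : 0 < C + 1 by lra.
apply: le_trans (h (e / (C + 1)) _) _; first by rewrite divr_gt0.
by rewrite mulrA ler_pdivrMr // mulrC ler_pM2l //; lra.
Qed.

(* 1 - s is the limit of y 0 = 0, y n.+1 = (x + (y n) ^+ 2) / 2, whose increments
   are dominated by those of the same scalar recursion with x = 1. *)
Lemma sqrt_1B x : cnorm x <= 1 ->
  exists s, [/\ s * s = 1 - x, cnorm (1 - s) <= 1, star x = x -> star s = s &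
    forall z, z * x = x * z -> z * s = s * z].
Proof.
move=> x1; pose half : R[i] := (2^-1)%:C%C.
have halfK z : half *: (z + z) = z.
  rewrite -mulr2n -[X in _ *: X]scaler_nat scalerA.
  rewrite -(rmorph_nat (real_complex R)) -rmorphM mulVf ?pnatr_eq0 //.
  by rewrite scale1r.
have nhalf z : cnorm (half *: z) = 2^-1 * cnorm z.
  by rewrite cnormZ normc_re ger0_norm ?invr_ge0.
pose y := fix y n := if n is n'.+1 then half *: (x + y n' * y n') else 0.
pose t := fix t n : R := if n is n'.+1 then 2^-1 * (1 + t n' ^+ 2) else 0.
have yS n : y n.+1 = half *: (x + y n * y n) by [].
have tS n : t n.+1 = 2^-1 * (1 + t n ^+ 2) by [].
have t01 n : 0 <= t n <= 1.
  elim: n => [|n /andP[h1 h2]]; first by rewrite lexx ler01.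
  by rewrite tS; apply/andP; split; nra.
have cy n z : z * x = x * z -> z * y n = y n * z.
  move=> zx; elim: n => [|n ih]; first by rewrite mulr0 mul0r.
  by rewrite yS -scalerAr -scalerAl mulrDr mulrDl zx mulrA ih -mulrA ih mulrA.
have cyy m n : y m * y n = y n * y m by apply: (cy n); rewrite (cy m).
have sy n : star x = x -> star (y n) = y n.
  move=> sx; elim: n => [|n ih]; first by rewrite star0.
  rewrite yS starZ starD starM sx ih; congr (_ *: _).
  by rewrite conjE /= oppr0.
have ny n : cnorm (y n) <= t n.
  elim: n => [|n ih]; first by rewrite cnorm0.
  rewrite yS tS nhalf ler_pM2l ?invr_gt0 //; apply: le_trans (cnormD _ _) _.
  apply: lerD => //; apply: le_trans (cnormM _ _) _.
  by rewrite expr2 ler_pM ?cnorm_ge0.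
have dy n : cnorm (y n.+1 - y n) <= t n.+1 - t n.
  elim: n => [|n ih].
    rewrite yS tS mul0r expr0n /= !addr0 !subr0 nhalf mulr1.
    by rewrite -[leRHS]mulr1 ler_pM2l ?invr_gt0.
  (* The difference of two squares factors because the iterates, limits of nothing but polynomials
     in [x], commute. *)
  have -> : y n.+2 - y n.+1 = half *: ((y n.+1 - y n) * (y n.+1 + y n)).
    rewrite (yS n.+1) [y n.+1 in X in _ - X](yS n) -scalerBr; congr (_ *: _).
    by rewrite opprD addrACA subrr add0r mulrBl !mulrDr (cyy n.+1 n) opprD addrA addrK.
  have -> : t n.+2 - t n.+1 = 2^-1 * ((t n.+1 - t n) * (t n.+1 + t n)).
    by rewrite (tS n.+1) [in X in _ - X](tS n); ring.
  rewrite nhalf ler_pM2l ?invr_gt0 //; apply: le_trans (cnormM _ _) _.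
  rewrite ler_pM ?cnorm_ge0 //; apply: le_trans (cnormD _ _) _.
  exact: lerD.
have tincr n : t n <= t n.+1.
  by rewrite -subr_ge0; apply: le_trans (dy n); exact: cnorm_ge0.
have dmn m n : (m <= n)%N -> cnorm (y n - y m) <= t n - t m.
  move=> mn; rewrite -(subnKC mn); elim: (n - m)%N => [|k ih].
    by rewrite addn0 !subrr cnorm0.
  rewrite addnS -(subrKA (y (m + k)%N)); apply: le_trans (cnormD _ _) _.
  by have := dy (m + k)%N; lra.
have tcauchy (e : R) : 0 < e -> exists N, forall n, (N <= n)%N -> t n - t N < e.
  move=> e0; pose S := [set t n | n in [set: nat]]%classic.
  have Ssup : has_sup S.
    by split; [exists (t 0), 0|exists 1 => _ [n _ <-]; case/andP: (t01 n)].
  have [_ [N _ <-] h] := sup_adherent e0 Ssup.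
  exists N => n Nn; have : t n <= sup S by apply: ub_le_sup; [exact: Ssup.2|exists n].
  by lra.
have [|l hl] := cnorm_complete y.
  move=> e e0; have [|N hN] := tcauchy (e / 2); first by rewrite divr_gt0.
  exists N => m n Nm Nn; rewrite -(subrKA (y N)); apply: le_lt_trans (cnormD _ _) _.
  rewrite -(cnormN (y N - y n)) opprB.
  by have := hN _ Nm; have := hN _ Nn; have := dmn _ _ Nm; have := dmn _ _ Nn; lra.
have hl' e : 0 < e -> exists n, cnorm (l - y n) < e /\ cnorm (l - y n.+1) < e.
  move=> /hl[N hN]; exists N; rewrite -(cnormN (l - y N)) -(cnormN (l - y N.+1)).
  by rewrite !opprB; split; apply: hN.
have ny1 n : cnorm (y n) <= 1 by apply: le_trans (ny n) _; case/andP: (t01 n).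
have nl : cnorm l <= 1.
  apply/ler_addgt0Pr => e /hl'[n [h _]]; rewrite -(subrK (y n) l).
  by apply: le_trans (cnormD _ _) _; have := ny1 n; lra.
(* The fixed-point equation of the recursion, which says that [1 - l] squares to [1 - x]. The defect
   splits into four terms of norm at most [e], whence the constant 4. *)
have lE : x + l * l = l + l.
  apply/eqP; rewrite -subr_eq0; apply/eqP; apply: (@cnorm_small 4) => e /hl'[n [h1 h2]].
  have -> : x + l * l - (l + l) =
      ((l - y n) * l + y n * (l - y n)) - ((l - y n.+1) + (l - y n.+1)).
    have : y n.+1 + y n.+1 = x + y n * y n by rewrite yS -scalerDr halfK.
    move=> h; rewrite mulrBl mulrBr addrA subrK addrACA -opprD h opprB addrA.
    have abel (a b c d : A) : a + b - c = b - d + (a + d) - c.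
      by rewrite [a + d]addrC addrA subrK [a + b]addrC.
    exact: abel.
  apply: le_trans (cnormB _ _) _.
  have -> : 4 * e = (e + e) + (e + e) by ring.
  apply: lerD; apply: le_trans (cnormD _ _) _; apply: lerD; rewrite ?(ltW h2) //.
    apply: le_trans (cnormM _ _) _; rewrite -[leRHS]mulr1.
    by rewrite ler_pM ?cnorm_ge0 // ltW.
  apply: le_trans (cnormM _ _) _; rewrite -[leRHS]mul1r.
  by rewrite ler_pM ?cnorm_ge0 // ltW.
exists (1 - l); split.
- have -> : x = l + l - l * l by rewrite -lE addrK.
  by rewrite mulrBl mul1r mulrBr mulr1 !opprB opprD addrACA !addrA.
- by rewrite opprB addrC subrK.
- move=> sx; rewrite starD star1 starN; congr (_ - _).
  apply/eqP; rewrite -subr_eq0; apply/eqP; apply: (@cnorm_small 2) => e /hl'[n [h _]].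
  rewrite -(subrKA (y n)) -{1}(sy n sx) -starN -starD; apply: le_trans (cnormD _ _) _.
  by rewrite cnorm_star -(cnormN (y n - l)) opprB; lra.
- move=> z zx; rewrite mulrBr mulrBl mulr1 mul1r; congr (_ - _).
  apply/eqP; rewrite -subr_eq0; apply/eqP.
  apply: (@cnorm_small (2 * cnorm z)) => e /hl'[n [h _]].
  have -> : z * l - l * z = z * (l - y n) - (l - y n) * z.
    by rewrite mulrBr mulrBl (cy _ _ zx) opprB addrA subrK.
  apply: le_trans (cnormB _ _) _.
  rewrite -mulrA [2 * _]mulrDl !mul1r; apply: lerD; apply: le_trans (cnormM _ _) _.
    by apply: ler_wpM2l; rewrite ?cnorm_ge0 // ltW.
  by rewrite mulrC; apply: ler_wpM2l; rewrite ?cnorm_ge0 // ltW.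
Qed.

End SquareRoots.

(** * Faithful representations and positivity *)

Section Positivity.
Variables (R : realType) (A : cstarAlgType R).
Implicit Types (a c d s x z : A) (k : R).

Lemma conj_real k : (k%:C%C : R[i])^* = k%:C%C.
Proof. by rewrite conjE /= oppr0. Qed.

Lemma star_realZ k x : star (k%:C%C *: x) = k%:C%C *: star x.
Proof. by rewrite starZ conj_real. Qed.

Lemma cnorm_realZ k x : 0 <= k -> cnorm (k%:C%C *: x) = k * cnorm x.
Proof. by move=> k0; rewrite cnormZ normc_re ger0_norm. Qed.

(* d + i c is k times a unitary. *)
Lemma cnorm_sa_le c d k : star c = c -> star d = d -> c * d = d * c ->
  c * c + d * d = (k ^+ 2)%:C%C%:A -> 0 <= k -> cnorm d <= k.
Proof.
move=> sc sd cd E k0; pose u := d + 'i%C *: c.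
have su : star u = d - 'i%C *: c.
  by rewrite starD starZ sc sd conj_im scaleNr.
have nu : cnorm u = k.
  apply/eqP; rewrite -(@eqrXn2 _ 2) ?cnorm_ge0 // -cnorm_star_mul su.
  have -> : (d - 'i%C *: c) * u = c * c + d * d.
    rewrite /u mulrBl !mulrDr -!scalerAl -!scalerAr scalerA cd opprD addrA addrK.
    have -> : 'i%C * 'i%C = -1 :> R[i] by rewrite -expr2 sqr_i.
    by rewrite scaleN1r opprK addrC.
  by rewrite E cnorm_realZ ?sqr_ge0 // cnorm1 mulr1.
have : cnorm (d + d) <= k + k.
  have -> : d + d = u + star u by rewrite su /u addrACA subrr addr0.
  by apply: le_trans (cnormD _ _) _; rewrite cnorm_star nu.
have -> : d + d = (2 : R)%:C%C *: d by rewrite rmorph_nat scaler_nat mulr2n.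
by rewrite cnorm_realZ //; lra.
Qed.

(** [c * c] plays the role of the absolute value of [a]. For [cnorm a <= 1], three uses of [sqrt_1B]
    give [s ^+ 2 = 1 - a ^+ 2], [t ^+ 2 = a ^+ 2] and [c ^+ 2 = t]. The second needs
    [cnorm (1 - a ^+ 2) <= 1], obtained from [cnorm s <= 1]; the third needs [cnorm (1 - t) <= 1],
    which [sqrt_1B] provides. *)
Lemma sa_fourth_root a : star a = a ->
  exists c, [/\ star c = c, (c * c) * (c * c) = a * a &
    forall z, z * a = a * z -> z * c = c * z].
Proof.
wlog a1 : a / cnorm a <= 1.
  move=> H sa; pose k := cnorm a + 1.
  have k0 : 0 < k by rewrite ltr_wpDl ?cnorm_ge0.
  have kn : k%:C%C != 0 :> R[i] by rewrite eq_complex /= eqxx andbT gt_eqF.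
  pose b := (k^-1)%:C%C *: a.
  have aE : a = k%:C%C *: b by rewrite /b fmorphV scalerA divff // scale1r.
  have nb : cnorm b <= 1.
    by rewrite cnorm_realZ ?invr_ge0 ?(ltW k0) // ler_pdivrMl // mulr1 lerDl.
  have sb : star b = b by rewrite star_realZ sa.
  have cb z : z * a = a * z -> z * b = b * z.
    by move=> za; rewrite /b -scalerAl -scalerAr za.
  clearbody b; have [c [sc cE cc]] := H b nb sb.
  exists ((Num.sqrt k)%:C%C *: c); split.
  - by rewrite star_realZ sc.
  - rewrite aE -!(scalerAl, scalerAr) !scalerA cE; congr (_ *: _).
    have kk : k = Num.sqrt k * Num.sqrt k by rewrite -expr2 sqr_sqrtr // ltW.
    by rewrite -!rmorphM {5 6}kk; congr (_%:C%C); ring.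
  - by move=> z /cb/cc zc; rewrite -scalerAl -scalerAr zc.
move=> sa.
have aa1 : cnorm (a * a) <= 1.
  by apply: le_trans (cnormM _ _) _; rewrite -[leRHS]mulr1 ler_pM ?cnorm_ge0.
have saa : star (a * a) = a * a by rewrite starM sa.
have caa z : z * a = a * z -> z * (a * a) = a * a * z.
  by move=> za; rewrite mulrA za -mulrA za mulrA.
have [s [ss _ /(_ saa) sas /(_ a (caa a erefl)) sc]] := sqrt_1B aa1.
have s1 : cnorm s <= 1.
  apply: (@cnorm_sa_le a); rewrite ?ss // addrC subrK expr1n.
  by rewrite scale1r.
have b1 : cnorm (1 - a * a) <= 1.
  rewrite -ss; apply: le_trans (cnormM _ _) _.
  by rewrite -[leRHS]mulr1 ler_pM ?cnorm_ge0.
have starB1 x : star x = x -> star (1 - x) = 1 - x.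
  by move=> sx; rewrite starD starN star1 sx.
have comB1 z x : z * x = x * z -> z * (1 - x) = (1 - x) * z.
  by move=> zx; rewrite mulrBr mulrBl mulr1 mul1r zx.
have [t [tt t1 /(_ (starB1 _ saa)) st ct]] := sqrt_1B b1.
have [c [cc _ /(_ (starB1 _ st)) stc ctc]] := sqrt_1B t1.
exists c; split=> //.
  by rewrite cc subKr tt subKr.
by move=> z za; apply/ctc/comB1/ct/comB1/caa.
Qed.

(** Writing [x = k y] with [cnorm y <= 1], take [k] times a square root of [1 - star y * y].
    Exhibiting the defect as a square makes it positive under every representation and every
    state. *)
Lemma norm_defect x k : cnorm x <= k ->
  exists2 s, star s = s & s * s = (k ^+ 2)%:C%C%:A - star x * x.
Proof.
move=> xk; have k0 : 0 <= k by apply: le_trans xk; exact: cnorm_ge0.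
have [ke|kn] := eqVneq k 0.
  have -> : x = 0.
    by apply/cnorm0_eq0/eqP; rewrite eq_le cnorm_ge0 andbT -[leRHS]ke.
  by exists 0; rewrite ?star0 // ke expr0n scale0r !mulr0 subrr.
have kp : 0 < k by rewrite lt_def kn.
pose y := (k^-1)%:C%C *: x; have xE : x = k%:C%C *: y.
  rewrite /y fmorphV scalerA divff ?scale1r //.
  by rewrite eq_complex /= eqxx andbT.
have y1 : cnorm y <= 1 by rewrite cnorm_realZ ?invr_ge0 // ler_pdivrMl // mulr1.
clearbody y; have yy1 : cnorm (star y * y) <= 1.
  by rewrite cnorm_star_mul expr_le1 ?cnorm_ge0.
have [s [ss _ sas _]] := sqrt_1B yy1.
exists (k%:C%C *: s); first by rewrite star_realZ sas // starM starK.
rewrite xE star_realZ -!(scalerAl, scalerAr) !scalerA -!rmorphM ss.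
by rewrite expr2 scalerBr.
Qed.

End Positivity.

(* The space need not be complete, so that direct powers of H can be used for matrix
   algebras without making them a hilbertType. *)
Record star_rep (R : realType) (A : starAlgType R) := StarRep {
  rep_space : lmodType R[i];
  rep_form : rep_space -> rep_space -> R[i];
  rep_act : A -> rep_space -> rep_space;
  rep_form_linear : forall w, scalar (rep_form^~ w);
  rep_form_conj : forall v w, rep_form w v = (rep_form v w)^*;
  rep_form_ge0 : forall v, 0 <= rep_form v v;
  rep_form_eq0 : forall v, rep_form v v = 0 -> v = 0;
  rep_act_linear : forall v, linear (rep_act^~ v);
  rep_act1 : forall v, rep_act 1 v = v;
  rep_actM : forall x y v, rep_act (x * y) v = rep_act x (rep_act y v);
  rep_act_star : forall x v w,
    rep_form (rep_act x v) w = rep_form v (rep_act (star x) w);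
  rep_act_bounded : forall x, exists2 M : R, 0 <= M & forall v,
    form_norm rep_form (rep_act x v) <= M * form_norm rep_form v;
  rep_faithful : forall x, (forall v, rep_act x v = 0) -> x = 0 }.

Section StarRep.
Variables (R : realType) (A : starAlgType R) (r : star_rep A).
Local Notation K := (rep_space r).
Local Notation f := (@rep_form _ _ r).
Local Notation act := (@rep_act _ _ r).
Local Notation Re := complex.Re.
Local Notation normc := ComplexField.Normc.normc.
Implicit Types (x y z : A) (u v w : K) (M : R).

Definition rep_norm := form_norm f.
Local Notation n := rep_norm.

Lemma rep_formDl u v w : f (u + v) w = f u w + f v w.
Proof. by have := rep_form_linear w 1 u v; rewrite scale1r mul1r. Qed.

Lemma rep_formDr u v w : f u (v + w) = f u v + f u w.
Proof. by rewrite rep_form_conj rep_formDl rmorphD /= -!(rep_form_conj _ u). Qed.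

Lemma rep_form0l w : f 0 w = 0.
Proof. by apply: (addrI (f 0 w)); rewrite -rep_formDl !addr0. Qed.

Lemma rep_formZl c v w : f (c *: v) w = c * f v w.
Proof. by have := rep_form_linear w c v 0; rewrite !addr0 rep_form0l addr0. Qed.

Lemma rep_formZr c v w : f v (c *: w) = c^* * f v w.
Proof. by rewrite rep_form_conj rep_formZl rmorphM /= -rep_form_conj. Qed.

Lemma rep_norm_ge0 v : 0 <= n v.
Proof. exact: form_norm_ge0. Qed.

Lemma rep_norm_sqr v : n v ^+ 2 = Re (f v v).
Proof. exact: form_norm_sqr (@rep_form_ge0 _ _ r) v. Qed.

Lemma rep_norm0_eq0 v : n v = 0 -> v = 0.
Proof. by move/(form_norm0_eq0 (@rep_form_ge0 _ _ r))/rep_form_eq0. Qed.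

Lemma rep_norm0 : n 0 = 0.
Proof. by rewrite /n /form_norm rep_form0l sqrtr0. Qed.

Lemma rep_normD u v : n (u + v) <= n u + n v.
Proof.
exact: form_normD (@rep_form_linear _ _ r) rep_formDr rep_formZr (@rep_form_ge0 _ _ r) u v.
Qed.

Lemma rep_normZ c v : n (c *: v) = normc c * n v.
Proof. exact: form_normZ (@rep_form_linear _ _ r) rep_formZr c v. Qed.

Lemma rep_norm_CS u v : Re (f u v) <= n u * n v.
Proof.
exact: form_norm_CS (@rep_form_linear _ _ r) rep_formDr rep_formZr (@rep_form_ge0 _ _ r) u v.
Qed.

Lemma rep_actD x y v : act (x + y) v = act x v + act y v.
Proof. by have := rep_act_linear v 1 x y; rewrite !scale1r. Qed.

Lemma rep_act0 v : act 0 v = 0.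
Proof. by apply: (addrI (act 0 v)); rewrite -rep_actD !addr0. Qed.

Lemma rep_actZ c x v : act (c *: x) v = c *: act x v.
Proof. by have := rep_act_linear v c x 0; rewrite !addr0 rep_act0 addr0. Qed.

Lemma rep_actN x v : act (- x) v = - act x v.
Proof. by rewrite -[- x]scaleN1r rep_actZ scaleN1r. Qed.

Lemma rep_form_sqr x v : f (act (star x * x) v) v = f (act x v) (act x v).
Proof. by rewrite rep_actM rep_act_star starK. Qed.

Definition op_norm x : R :=
  inf [set M | 0 <= M /\ forall v, n (act x v) <= M * n v]%classic.

Lemma op_norm_has_inf x :
  has_inf [set M | 0 <= M /\ forall v, n (act x v) <= M * n v]%classic.
Proof.
split; last by exists 0 => M [].
by have [M M0 h] := rep_act_bounded r x; exists M.
Qed.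

Lemma op_norm_ge0 x : 0 <= op_norm x.
Proof. by apply: lb_le_inf; [case: (op_norm_has_inf x)|move=> M []]. Qed.

Lemma op_norm_le x M : 0 <= M -> (forall v, n (act x v) <= M * n v) -> op_norm x <= M.
Proof. by move=> M0 h; apply: ge_inf; [case: (op_norm_has_inf x)|]. Qed.

Lemma op_normP x v : n (act x v) <= op_norm x * n v.
Proof.
have [v0|v0] := eqVneq (n v) 0.
  have [M _ /(_ v)] := rep_act_bounded r x.
  by rewrite -/(rep_norm v) v0 !mulr0.
have vp : 0 < n v by rewrite lt_def v0 rep_norm_ge0.
rewrite -ler_pdivrMr //; apply: lb_le_inf; first by case: (op_norm_has_inf x).
by move=> M [_ /(_ v)]; rewrite ler_pdivrMr.
Qed.

Lemma op_normD x y : op_norm (x + y) <= op_norm x + op_norm y.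
Proof.
apply: op_norm_le => [|v]; first by rewrite addr_ge0 ?op_norm_ge0.
rewrite rep_actD mulrDl; apply: le_trans (rep_normD _ _) _.
by rewrite lerD ?op_normP.
Qed.

Lemma op_normZ c x : op_norm (c *: x) = normc c * op_norm x.
Proof.
have le d y : op_norm (d *: y) <= normc d * op_norm y.
  apply: op_norm_le => [|v]; first by rewrite mulr_ge0 ?normc_nonneg ?op_norm_ge0.
  by rewrite rep_actZ rep_normZ -mulrA ler_wpM2l ?normc_nonneg ?op_normP.
apply/eqP; rewrite eq_le le /=; have [->|c0] := eqVneq c 0.
  by rewrite ComplexField.Normc.normc0 mul0r op_norm_ge0.
have cp : 0 < normc c.
  rewrite lt_def normc_nonneg andbT; apply: contra c0 => /eqP.
  by move/ComplexField.Normc.eq0_normc => ->.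
rewrite -ler_pdivlMl // -ComplexField.Normc.normcV; apply: le_trans (le _ _).
by rewrite scalerA mulVf // scale1r.
Qed.

Lemma op_norm0_eq0 x : op_norm x = 0 -> x = 0.
Proof.
move=> h; apply: (@rep_faithful _ _ r) => v; apply: rep_norm0_eq0; apply/eqP.
by rewrite eq_le rep_norm_ge0 andbT; have := op_normP x v; rewrite h mul0r.
Qed.

Lemma op_normM x y : op_norm (x * y) <= op_norm x * op_norm y.
Proof.
apply: op_norm_le => [|v]; first by rewrite mulr_ge0 ?op_norm_ge0.
rewrite rep_actM -mulrA; apply: le_trans (op_normP _ _) _.
by rewrite ler_wpM2l ?op_norm_ge0 ?op_normP.
Qed.

(** Cauchy-Schwarz bounds the squared norm of [y v], the pairing of [star y * y v] with [v], by the
    operator norm of [star y * y]. With submultiplicativity this also gives that [star] preserves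
    the norm, hence the reverse inequality. *)
Lemma op_norm_star_mul x : op_norm (star x * x) = op_norm x ^+ 2.
Proof.
have le y : op_norm y ^+ 2 <= op_norm (star y * y).
  have N0 := op_norm_ge0 (star y * y).
  rewrite -[leRHS]sqr_sqrtr // ler_pXn2r ?nnegrE ?op_norm_ge0 ?sqrtr_ge0 //.
  apply: op_norm_le => [|v]; first exact: sqrtr_ge0.
  rewrite -(@ler_pXn2r _ 2) ?nnegrE ?mulr_ge0 ?rep_norm_ge0 ?sqrtr_ge0 //.
  rewrite exprMn (sqr_sqrtr N0) !rep_norm_sqr -rep_form_sqr -rep_norm_sqr.
  apply: le_trans (rep_norm_CS _ _) _; rewrite expr2 mulrA ler_wpM2r ?rep_norm_ge0 //.
  exact: op_normP.
have le_star y : op_norm y <= op_norm (star y).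
  have := le_trans (le y) (op_normM _ _); rewrite expr2.
  have [->|n0] := eqVneq (op_norm y) 0; first by rewrite op_norm_ge0.
  by rewrite ler_pM2r // lt_def n0 op_norm_ge0.
apply/eqP; rewrite eq_le le andbT; apply: le_trans (op_normM _ _) _.
by rewrite expr2 ler_wpM2r ?op_norm_ge0 //; have := le_star (star x); rewrite starK.
Qed.

End StarRep.

Section CStarRep.
Variables (R : realType) (A : cstarAlgType R) (r : star_rep A).
Local Notation f := (@rep_form _ _ r).
Local Notation act := (@rep_act _ _ r).
Local Notation n := (@rep_norm _ _ r).
Local Notation Re := complex.Re.

(* With b = |a| = c * c and m = b - a twice the negative part of a, one has
   b * m + a * m = 0, so (c * m)^* (c * m) = m * b * m = - m * a * m acts both positively
   and negatively. Hence m * b * m = m * a * m = 0, and m ^+ 3 = 0. *)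
Lemma rep_positive (a : A) : star a = a -> (forall v, 0 <= f (act a v) v) ->
  exists c, [/\ star c = c, a = c * c & forall z, z * a = a * z -> z * c = c * z].
Proof.
move=> sa pa; have [c [sc cE cc]] := sa_fourth_root sa.
exists c; split=> //; apply/eqP; rewrite eq_sym -subr_eq0; apply/eqP.
set b := c * c in cE *; pose m := b - a.
have ab : a * b = b * a.
  have h : a * c = c * a by exact: cc.
  by rewrite /b mulrA h -mulrA h mulrA.
have sm : star m = m by rewrite /m starD starN sa /b starM sc.
have bam : (b + a) * m = 0.
  by rewrite /m mulrBr !mulrDl ab cE [a * a + _]addrC subrr.
have mbm : m * b * m = - (m * a * m).
  by apply/eqP; rewrite -addr_eq0 -!(mulrA m) -mulrDr -mulrDl bam mulr0.
have z : m * b * m = 0.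
  have pm v : f (act (m * b * m) v) v = f (act (c * m) v) (act (c * m) v).
    rewrite -rep_form_sqr starM sm sc; congr (f (act _ v) v).
    by rewrite /b !mulrA.
  have nm v : f (act (m * b * m) v) v <= 0.
    rewrite mbm rep_actN -scaleN1r rep_formZl mulN1r oppr_le0.
    by rewrite -mulrA rep_actM rep_act_star sm rep_actM pa.
  have cm : c * m = 0.
    apply: (@rep_faithful _ _ r) => v; apply: rep_form_eq0; apply/eqP.
    by rewrite eq_le rep_form_ge0 andbT -pm nm.
  by rewrite /b mulrA -mulrA cm mulr0.
have mam : m * a * m = 0 by apply/eqP; rewrite -oppr_eq0 -mbm z.
have m3 : m * m * m = 0 by rewrite -[RHS](subrr 0) -{1}z -mam -mulrBl -mulrBr.
have sqr0 (x : A) : star x * x = 0 -> x = 0.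
  move=> h; apply/cnorm0_eq0/eqP; rewrite -sqrf_eq0 -cnorm_star_mul h.
  by rewrite cnorm0.
(* The C*-identity is used twice: [m ^+ 4 = 0] gives [m ^+ 2 = 0], which gives [m = 0]. *)
by apply: (sqr0); rewrite sm; apply: sqr0; rewrite starM sm mulrA m3 mul0r.
Qed.

(** With [s] from [norm_defect], the difference of the squares of the two sides is the squared norm
    of [act s v]. *)
Lemma rep_norm_act (x : A) v : n (act x v) <= cnorm x * n v.
Proof.
have [s ss sE] := norm_defect (lexx (cnorm x)).
rewrite -(@ler_pXn2r _ 2) ?nnegrE ?mulr_ge0 ?cnorm_ge0 ?rep_norm_ge0 //.
rewrite exprMn !rep_norm_sqr -rep_form_sqr -ReZ -subr_ge0 -ReB.
rewrite -rep_formZl -mulN1r -rep_formZl scaleN1r -rep_formDl -rep_actN.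
rewrite -{1}[v]rep_act1 -rep_actZ -rep_actD -sE -{1}ss rep_form_sqr.
exact/ge0_Re/rep_form_ge0.
Qed.

(** The bound makes [M ^+ 2 - star x * x] act positively, so by [rep_positive] it is some [c * c],
    while [star x * x = d * d] with [d] commuting with [c]. Then [cnorm_sa_le] yields
    [cnorm d <= M]. Together with [rep_norm_act], faithful representations are isometric. *)
Lemma cnorm_le_rep (x : A) M : 0 <= M ->
  (forall v, n (act x v) <= M * n v) -> cnorm x <= M.
Proof.
move=> M0 h.
have sh : star (star x * x) = star x * x by rewrite starM starK.
have [|v|d [sd dE cd]] := @rep_positive (star x * x); first by [].
  by rewrite rep_form_sqr rep_form_ge0.
pose g := (M ^+ 2)%:C%C%:A - star x * x.
have sg : star g = g by rewrite /g starD starN sh star_realZ star1.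
have [|v|c [sc cE cc]] := @rep_positive g; first by [].
  rewrite rep_actD rep_actN rep_actZ rep_act1 -scaleN1r rep_formDl !rep_formZl mulN1r.
  rewrite rep_form_sqr subr_ge0 (ge0_ReK (rep_form_ge0 (act x v))).
  rewrite (ge0_ReK (rep_form_ge0 v)) -rmorphM lecR -!rep_norm_sqr -exprMn.
  by rewrite ler_pXn2r ?nnegrE ?mulr_ge0 ?rep_norm_ge0.
have cdC : c * d = d * c.
  have dh : d * (star x * x) = star x * x * d by rewrite dE mulrA.
  by apply/esym/cc; rewrite /g mulrBr mulrBl dh -scalerAr -scalerAl mul1r mulr1.
have nd : cnorm d <= M.
  by apply: (@cnorm_sa_le _ _ c) => //; rewrite -cE -dE subrK.
rewrite -(@ler_pXn2r _ 2) ?nnegrE ?cnorm_ge0 // -cnorm_star_mul dE.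
apply: le_trans (cnormM _ _) _; rewrite expr2.
by rewrite ler_pM ?cnorm_ge0.
Qed.

End CStarRep.

(** * Operator norms on B(H) *)

Section OperatorNorm.
Variables (R : realType) (H : hilbertType R).
Local Notation B := (bounded_operator H).
Local Notation Re := complex.Re.
Implicit Types (S T : B) (x y : H).

Lemma form_norm_dot x : form_norm (@dot R H) x = Re `|x|.
Proof.
rewrite /form_norm dot_norm (ge0_ReK (normr_ge0 x)) -rmorphXn /= sqrtr_sqr.
by rewrite ger0_norm // ge0_Re.
Qed.

Fact bop_dot_linear y : scalar ((@dot R H)^~ y).
Proof. by move=> c x z; rewrite dotDl dotZl. Qed.
Fact bop_dot_ge0 x : 0 <= dot x x.
Proof. by rewrite dot_norm exprn_ge0. Qed.
Fact bop_dot_eq0 x : dot x x = 0 -> x = 0.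
Proof. by rewrite dot_norm => /eqP; rewrite sqrf_eq0 normr_eq0 => /eqP. Qed.
Fact bop_rep_linear x : linear (fun T : B => T x).
Proof. by []. Qed.
Fact bop_rep_bounded T : exists2 M : R, 0 <= M & forall x,
  form_norm (@dot R H) (T x) <= M * form_norm (@dot R H) x.
Proof.
have [M M0 h] := bop_bound_ge0 T; exists M => // x.
by rewrite !form_norm_dot -ReZ; exact/Re_le/h.
Qed.
Fact bop_rep_faithful T : (forall x, T x = 0) -> T = 0.
Proof. by move=> h; apply: bopP => x; rewrite h. Qed.

Definition bop_rep : star_rep B :=
  @StarRep R B H (@dot R H) (@bop_fun R H) bop_dot_linear (@dot_conj R H)
    bop_dot_ge0 bop_dot_eq0 bop_rep_linear (fun x => erefl)
    (fun S T x => erefl) (@adjointE R H) bop_rep_bounded bop_rep_faithful.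

Local Notation n := (@rep_norm R B bop_rep).

Lemma hilbert_complete (u : nat -> H) :
  (forall e : R, 0 < e -> exists M, forall i j,
     (M <= i)%N -> (M <= j)%N -> n (u i - u j) < e) ->
  exists l, forall e : R, 0 < e -> exists M, forall i,
     (M <= i)%N -> n (u i - l) < e.
Proof.
have nE x : `|x| = (n x)%:C%C by rewrite /n form_norm_dot -ge0_ReK.
move=> hu; have : (cauchy (u @ \oo))%classic.
  apply: cauchy_exP => e e0.
  have eE := ge0_ReK (ltW e0); rewrite eE in e0 *.
  have [|M hM] := hu (Re e); first by move: e0; rewrite ltcR.
  exists (u M); exists M => // i /= Mi.
  by rewrite -ball_normE /= nE ltcR; exact: hM.
move=> /cauchy_cvg/cvg_ex[l /cvgrPdist_lt hl]; exists l => e e0.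
have [|M _ hM] := hl e%:C%C; first by rewrite ltcR.
by exists M => i /hM /=; rewrite distrC nE ltcR.
Qed.

(** The limit is built pointwise from the completeness of [H]; [unif] makes the convergence uniform
    on bounded sets, and linearity, boundedness and norm convergence follow from it. *)
Lemma op_norm_complete (u : nat -> B) :
  (forall e : R, 0 < e -> exists N, forall i j,
     (N <= i)%N -> (N <= j)%N -> op_norm bop_rep (u i - u j) < e) ->
  exists L : B, forall e : R, 0 < e -> exists N, forall i,
     (N <= i)%N -> op_norm bop_rep (u i - L) < e.
Proof.
move=> hu.
have nd i j x : n (u i x - u j x) <= op_norm bop_rep (u i - u j) * n x.
  have -> : u i x - u j x = (u i - u j) x by rewrite -[- u j x]scaleN1r.
  exact: (@op_normP _ _ bop_rep (u i - u j) x).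
have ex x : exists l, forall e : R, 0 < e -> exists N, forall i,
    (N <= i)%N -> n (u i x - l) < e.
  apply: hilbert_complete => e e0.
  have x1 : 0 < n x + 1 by rewrite ltr_wpDl ?rep_norm_ge0.
  have [|N hN] := hu (e / (n x + 1)); first by rewrite divr_gt0.
  exists N => i j Ni Nj; apply: le_lt_trans (nd _ _ _) _.
  have := hN i j Ni Nj; rewrite ltr_pdivlMr //; apply: le_lt_trans.
  by rewrite ler_wpM2l ?op_norm_ge0 // lerDl.
have [l hl] := choice ex.
have nN x y : n (x - y) = n (y - x) by rewrite /n !form_norm_dot distrC.
have unif e : 0 < e -> exists N, forall i, (N <= i)%N -> forall x, n (u i x - l x) <= e * n x.
  move=> e0; have [N hN] := hu e e0; exists N => i Ni x.
  apply/ler_addgt0Pr => d d0; have [N' hN'] := hl x d d0.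
  have := hN' _ (leq_maxl N' N); have := hN i _ Ni (leq_maxr N' N).
  set k := maxn N' N => h1 h2; rewrite -(subrKA (u k x)).
  apply: le_trans (rep_normD _ _) _; apply: lerD; last exact: ltW.
  apply: le_trans (nd _ _ _) _; rewrite ler_wpM2r ?rep_norm_ge0 //.
  exact: ltW.
have llin : linear l.
  move=> c x y; apply/eqP; rewrite -subr_eq0; apply/eqP.
  apply: (@rep_norm0_eq0 _ _ bop_rep); apply/eqP; rewrite eq_le rep_norm_ge0 andbT.
  set z := l _ - _.
  pose C := n (c *: x + y) + ComplexField.Normc.normc c * n x + n y.
  have C0 : 0 <= C by rewrite !addr_ge0 ?mulr_ge0 ?rep_norm_ge0 ?normc_nonneg.
  apply/ler_addgt0Pr => e e0; rewrite add0r.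
  have C1 : 0 < C + 1 by lra.
  have [|N /(_ N (leqnn N)) h] := unif (e / (C + 1)); first by rewrite divr_gt0.
  have -> : z = - (u N (c *: x + y) - l (c *: x + y))
      + (c *: (u N x - l x) + (u N y - l y)).
    rewrite /z bop_linear scalerBr addrACA -opprD opprB.
    by rewrite [in RHS]addrA [X in _ = X + _]addrC addrA addrAC subrr add0r addrC.
  have DE : e / (C + 1) * C <= e by rewrite mulrAC ler_pdivrMr // ler_pM2l //; lra.
  apply: le_trans (rep_normD _ _) _; apply: le_trans DE; move: (e / _) h => D h.
  rewrite /C -[_ + _ + n y]addrA mulrDr opprB nN; apply: lerD => //.
  apply: le_trans (rep_normD _ _) _; rewrite mulrDr; apply: lerD => //.
  by rewrite (@rep_normZ _ _ bop_rep) mulrCA ler_wpM2l ?normc_nonneg.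
have lbdd : exists M : R, forall x, `|l x| <= M%:C%C * `|x|.
  have [N /(_ N (leqnn N)) h] := unif 1 ltr01.
  exists (1 + op_norm bop_rep (u N)) => x.
  rewrite (ge0_ReK (normr_ge0 (l x))) (ge0_ReK (normr_ge0 x)) -rmorphM lecR.
  rewrite -!form_norm_dot -!/(n _) mulrDl -(subrK (u N x) (l x)).
  apply: le_trans (rep_normD _ _) _; rewrite nN.
  by apply: lerD => //; exact: (@op_normP _ _ bop_rep (u N) x).
exists (BoundedOperator llin lbdd) => e e0.
have [|N hN] := unif (e / 2); first by rewrite divr_gt0.
exists N => i Ni; apply: (@le_lt_trans _ _ (e / 2)); last by lra.
apply: op_norm_le => [|x]; first by lra.
by have := hN i Ni x; rewrite -scaleN1r.
Qed.

(** Injectivity of the target algebra speaks of operator systems in C*-algebras; this structure lets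
    it extend UCP maps to all of B(H). *)
HB.instance Definition _ := isCStarAlgebra.Build R B
  (@op_normD R B bop_rep) (@op_normZ R B bop_rep) (@op_norm0_eq0 R B bop_rep)
  (@op_normM R B bop_rep) (@op_norm_star_mul R B bop_rep) op_norm_complete.

End OperatorNorm.

(** * Matrix algebras acting on direct powers of a representation *)

Section RepSums.
Variables (R : realType) (A : starAlgType R) (r : star_rep A).
Local Notation act := (@rep_act _ _ r).
Local Notation f := (@rep_form _ _ r).
Implicit Types (v w : rep_space r).

Lemma star_sum I (s : seq I) P (F : I -> A) :
  star (\sum_(i <- s | P i) F i) = \sum_(i <- s | P i) star (F i).
Proof. exact: (big_morph star (@starD R A) (star0 A)). Qed.

Lemma rep_act_sum I (s : seq I) P (F : I -> A) v :
  act (\sum_(i <- s | P i) F i) v = \sum_(i <- s | P i) act (F i) v.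
Proof.
by apply: (big_morph (act^~ v)) => [x y|]; [exact: rep_actD|exact: rep_act0].
Qed.

Lemma rep_form_suml I (s : seq I) P (F : I -> rep_space r) w :
  f (\sum_(i <- s | P i) F i) w = \sum_(i <- s | P i) f (F i) w.
Proof.
by apply: (big_morph (f^~ w)) => [x y|]; [exact: rep_formDl|exact: rep_form0l].
Qed.

Lemma rep_form0r v : f v 0 = 0.
Proof. by rewrite rep_form_conj rep_form0l rmorph0. Qed.

Lemma rep_form_sumr I (s : seq I) P (F : I -> rep_space r) w :
  f w (\sum_(i <- s | P i) F i) = \sum_(i <- s | P i) f w (F i).
Proof.
by apply: (big_morph (f w)) => [x y|]; [exact: rep_formDr|exact: rep_form0r].
Qed.

(** Additivity in the vector is not a field of [star_rep]: it follows from the existence of adjoints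
    and the definiteness of the form. *)
Lemma rep_act_sumr I (s : seq I) P (F : I -> rep_space r) x :
  act x (\sum_(i <- s | P i) F i) = \sum_(i <- s | P i) act x (F i).
Proof.
have inj u v : (forall w, f u w = f v w) -> u = v.
  move=> h; apply/eqP; rewrite -subr_eq0; apply/eqP/rep_form_eq0.
  by rewrite -{1}scaleN1r rep_formDl rep_formZl h mulN1r subrr.
by apply: inj => w; rewrite rep_act_star !rep_form_suml; apply: eq_bigr => i _;
  rewrite rep_act_star.
Qed.

End RepSums.

Section MatrixAlgebra.
Variables (R : realType) (A : starAlgType R) (r : star_rep A) (n : nat).

(* The norm depends on a representation, so the type has to mention it. The alias also
   hides the scaling by A that 'M[A]_n carries. *)
Definition matrix_alg (r' : star_rep A) : Type := 'M[A]_n.+1.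
Local Notation M := (matrix_alg r).
HB.instance Definition _ := GRing.NzRing.on M.

Definition mx_scale (c : R[i]) (X : M) : M := map_mx ( *:%R c) X.
Fact mx_scaleA a b X : mx_scale a (mx_scale b X) = mx_scale (a * b) X.
Proof. by apply/matrixP => i j; rewrite !mxE scalerA. Qed.
Fact mx_scale1 : left_id 1 mx_scale.
Proof. by move=> X; apply/matrixP => i j; rewrite !mxE scale1r. Qed.
Fact mx_scaleDr : right_distributive mx_scale +%R.
Proof. by move=> c X Y; apply/matrixP => i j; rewrite !mxE scalerDr. Qed.
Fact mx_scaleDl X : {morph mx_scale^~ X : a b / a + b}.
Proof. by move=> a b; apply/matrixP => i j; rewrite !mxE scalerDl. Qed.
HB.instance Definition _ := GRing.Zmodule_isLmodule.Build R[i] M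
  mx_scaleA mx_scale1 mx_scaleDr mx_scaleDl.
Fact mx_scaleAl (c : R[i]) (X Y : M) : c *: (X * Y) = c *: X * Y.
Proof.
apply/matrixP => i j; rewrite !mxE scaler_sumr; apply: eq_bigr => k _.
by rewrite !mxE scalerAl.
Qed.
HB.instance Definition _ := GRing.Lmodule_isLalgebra.Build R[i] M mx_scaleAl.
Fact mx_scaleAr (c : R[i]) (X Y : M) : c *: (X * Y) = X * (c *: Y).
Proof.
apply/matrixP => i j; rewrite !mxE scaler_sumr; apply: eq_bigr => k _.
by rewrite !mxE scalerAr.
Qed.
HB.instance Definition _ := GRing.Lalgebra_isAlgebra.Build R[i] M mx_scaleAr.

Definition mx_star (X : M) : M := star_mx X.
Fact mx_starK : involutive mx_star.
Proof. by move=> X; apply/matrixP => i j; rewrite !mxE starK. Qed.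
Fact mx_starD : {morph mx_star : X Y / X + Y}.
Proof. by move=> X Y; apply/matrixP => i j; rewrite !mxE starD. Qed.
Fact mx_starZ (c : R[i]) (X : M) : mx_star (c *: X) = c^* *: mx_star X.
Proof. by apply/matrixP => i j; rewrite !mxE starZ. Qed.
Fact mx_starM (X Y : M) : mx_star (X * Y) = mx_star Y * mx_star X.
Proof.
apply/matrixP => i j; rewrite !mxE star_sum; apply: eq_bigr => k _.
by rewrite !mxE starM.
Qed.
HB.instance Definition _ := isStarAlgebra.Build R M
  mx_starK mx_starD mx_starZ mx_starM.

Local Notation K := {ffun 'I_n.+1 -> rep_space r}.
Local Notation act := (@rep_act _ _ r).
Local Notation f := (@rep_form _ _ r).
Local Notation Re := complex.Re.
Implicit Types (X Y : M) (v w : K).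

Definition mx_form v w : R[i] := \sum_i f (v i) (w i).
Definition mx_act X v : K := [ffun i => \sum_j act (X i j) (v j)].

Fact mx_form_linear w : scalar (mx_form^~ w).
Proof.
move=> c u v; rewrite /mx_form mulr_sumr -big_split; apply: eq_bigr => i _ /=.
by rewrite !ffunE rep_formDl rep_formZl.
Qed.
Fact mx_form_conj v w : mx_form w v = (mx_form v w)^*.
Proof. by rewrite /mx_form rmorph_sum; apply: eq_bigr => i _; exact: rep_form_conj. Qed.
Fact mx_form_ge0 v : 0 <= mx_form v v.
Proof. by apply: sumr_ge0 => i _; exact: rep_form_ge0. Qed.
Fact mx_form_eq0 v : mx_form v v = 0 -> v = 0.
Proof.
move=> /psumr_eq0P h; apply/ffunP => i; rewrite ffunE.
by apply: rep_form_eq0; apply: h => // j _; exact: rep_form_ge0.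
Qed.
Fact mx_act_linear v : linear (mx_act^~ v).
Proof.
move=> c X Y; apply/ffunP => i; rewrite !ffunE scaler_sumr -big_split.
by apply: eq_bigr => j _; rewrite !mxE rep_actD rep_actZ.
Qed.
Fact mx_act1 v : mx_act 1 v = v.
Proof.
apply/ffunP => i; rewrite !ffunE (bigD1 i) //= mxE eqxx rep_act1 big1 ?addr0 //.
by move=> j ji; rewrite mxE eq_sym (negbTE ji) rep_act0.
Qed.
Fact mx_actM X Y v : mx_act (X * Y) v = mx_act X (mx_act Y v).
Proof.
apply/ffunP => i; rewrite !ffunE.
under eq_bigr do rewrite mxE rep_act_sum.
rewrite exchange_big; apply: eq_bigr => k _; rewrite ffunE rep_act_sumr.
by apply: eq_bigr => j _; rewrite rep_actM.
Qed.
Fact mx_act_star X v w : mx_form (mx_act X v) w = mx_form v (mx_act (star X) w).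
Proof.
rewrite /mx_form; under eq_bigr do rewrite ffunE rep_form_suml.
rewrite exchange_big; apply: eq_bigr => j _; rewrite ffunE rep_form_sumr.
by apply: eq_bigr => i _; rewrite rep_act_star !mxE.
Qed.
End MatrixAlgebra.

(** * The C*-norm of a matrix algebra *)

Section MatrixRep.
Variables (R : realType) (A : starAlgType R) (r : star_rep A) (n : nat).
Local Notation M := (matrix_alg n r).
Local Notation K := {ffun 'I_n.+1 -> rep_space r}.
Local Notation act := (@rep_act _ _ r).
Local Notation Re := complex.Re.
Local Notation N := (form_norm (@mx_form R A r n)).
Implicit Types (X Y : M) (v w : K).

Lemma Re_sum I (s : seq I) P (F : I -> R[i]) :
  Re (\sum_(i <- s | P i) F i) = \sum_(i <- s | P i) Re (F i).
Proof.
by elim/big_rec2: _ => [|i a b _ <-] //; rewrite ReD.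
Qed.

Lemma mx_norm_sqr v : N v ^+ 2 = \sum_i rep_norm (v i) ^+ 2.
Proof.
rewrite form_norm_sqr; last exact: mx_form_ge0.
by rewrite Re_sum; apply: eq_bigr => i _; rewrite rep_norm_sqr.
Qed.

Lemma rep_norm_le_mx v i : rep_norm (v i) <= N v.
Proof.
rewrite -(@ler_pXn2r _ 2) ?nnegrE ?form_norm_ge0 // mx_norm_sqr (bigD1 i) //=.
by rewrite lerDl sumr_ge0 // => j _; rewrite sqr_ge0.
Qed.

Lemma mx_norm_le_sum v : N v <= \sum_i rep_norm (v i).
Proof.
rewrite -(@ler_pXn2r _ 2) ?nnegrE ?form_norm_ge0 ?sumr_ge0 //; last first.
  by move=> i _; exact: rep_norm_ge0.
rewrite mx_norm_sqr; suff : 0 <= \sum_i rep_norm (v i) /\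
  \sum_i rep_norm (v i) ^+ 2 <= (\sum_i rep_norm (v i)) ^+ 2 by case.
elim/big_ind2: _ => [|a x b y [x0 xa] [y0 yb]|i _]; first by rewrite expr0n.
  split; first exact: addr_ge0.
  by apply: le_trans (lerD xa yb) _; rewrite sqrrD addrAC lerDl mulrn_wge0 ?mulr_ge0.
by rewrite rep_norm_ge0.
Qed.

Lemma rep_norm_sum I (s : seq I) P (F : I -> rep_space r) :
  rep_norm (\sum_(i <- s | P i) F i) <= \sum_(i <- s | P i) rep_norm (F i).
Proof.
elim/big_ind2: _ => [|a x b y xa yb|//]; first by rewrite rep_norm0.
by apply: le_trans (rep_normD _ _) _; exact: lerD.
Qed.

Lemma mx_act_le X v : N (mx_act X v) <= (\sum_i \sum_j op_norm r (X i j)) * N v.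
Proof.
apply: le_trans (mx_norm_le_sum _) _; rewrite mulr_suml; apply: ler_sum => i _.
rewrite ffunE mulr_suml; apply: le_trans (rep_norm_sum _ _ _) _.
apply: ler_sum => j _; apply: le_trans (op_normP _ _) _.
by rewrite ler_wpM2l ?op_norm_ge0 // rep_norm_le_mx.
Qed.

Definition single_vec j (u : rep_space r) : K := [ffun k => if k == j then u else 0].

Lemma mx_norm_single j u : N (single_vec j u) = rep_norm u.
Proof.
apply/eqP; rewrite -(@eqrXn2 _ 2) ?form_norm_ge0 ?rep_norm_ge0 // mx_norm_sqr.
rewrite (bigD1 j) //= ffunE eqxx big1 ?addr0 // => k kj.
by rewrite ffunE (negbTE kj) rep_norm0 expr0n.
Qed.

Lemma mx_act_single X i j u : mx_act X (single_vec j u) i = act (X i j) u.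
Proof.
rewrite ffunE (bigD1 j) //= ffunE eqxx big1 ?addr0 // => k kj.
rewrite ffunE (negbTE kj).
(* The empty sum gives that operators map 0 to 0. *)
by have := rep_act_sumr [::] (fun _ : nat => true) (fun _ => 0 : rep_space r) (X i k);
  rewrite !big_nil.
Qed.

Fact mx_rep_bounded X : exists2 C : R, 0 <= C & forall v, N (mx_act X v) <= C * N v.
Proof.
exists (\sum_i \sum_j op_norm r (X i j)); last exact: mx_act_le.
by rewrite !sumr_ge0 // => i _; rewrite sumr_ge0 // => j _; exact: op_norm_ge0.
Qed.

Fact mx_rep_faithful X : (forall v, mx_act X v = 0) -> X = 0.
Proof.
move=> h; apply/matrixP => i j; rewrite mxE; apply: (@rep_faithful _ _ r) => u.
by rewrite -mx_act_single h ffunE.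
Qed.

Definition mx_rep : star_rep M :=
  @StarRep R M K (@mx_form R A r n) (@mx_act R A r n)
    (@mx_form_linear R A r n) (@mx_form_conj R A r n) (@mx_form_ge0 R A r n)
    (@mx_form_eq0 R A r n) (@mx_act_linear R A r n) (@mx_act1 R A r n)
    (@mx_actM R A r n) (@mx_act_star R A r n) mx_rep_bounded mx_rep_faithful.

Lemma op_norm_mx_le X : op_norm mx_rep X <= \sum_i \sum_j op_norm r (X i j).
Proof.
apply: op_norm_le; last exact: mx_act_le.
by rewrite !sumr_ge0 // => i _; rewrite sumr_ge0 // => j _; exact: op_norm_ge0.
Qed.

Lemma op_norm_entry X i j : op_norm r (X i j) <= op_norm mx_rep X.
Proof.
apply: op_norm_le => [|u]; first exact: op_norm_ge0.
rewrite -mx_act_single -(mx_norm_single j u).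
by apply: le_trans (rep_norm_le_mx _ _) (@op_normP _ _ mx_rep X _).
Qed.

End MatrixRep.

Section MatrixCStar.
Variables (R : realType) (A : cstarAlgType R) (r : star_rep A) (n : nat).
Local Notation M := (matrix_alg n r).
Local Notation N := (op_norm (mx_rep r n)).

Lemma op_norm_cnorm (x : A) : op_norm r x = cnorm x.
Proof.
apply/eqP; rewrite eq_le op_norm_le ?cnorm_ge0 //=; last exact: rep_norm_act.
by apply: (@cnorm_le_rep _ _ r); [exact: op_norm_ge0|exact: op_normP].
Qed.

(** The operator norm of a matrix lies between the norm of each entry and the sum of the norms of
    all entries, so that limits can be taken entrywise. *)
Lemma mx_complete (u : nat -> M) :
  (forall e : R, 0 < e -> exists k, forall i j,
     (k <= i)%N -> (k <= j)%N -> N (u i - u j) < e) ->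
  exists L : M, forall e : R, 0 < e -> exists k, forall i,
     (k <= i)%N -> N (u i - L) < e.
Proof.
move=> hu.
have ex (p : 'I_n.+1 * 'I_n.+1) : exists l : A, forall e : R, 0 < e ->
    exists k, forall i, (k <= i)%N -> cnorm (u i p.1 p.2 - l) < e.
  apply: cnorm_complete => e /hu[k hk]; exists k => i j ki kj.
  apply: le_lt_trans (hk i j ki kj); rewrite -op_norm_cnorm.
  by apply: le_trans (op_norm_entry _ p.1 p.2); rewrite !mxE.
have [l hl] := choice ex.
pose L : M := \matrix_(i, j) l (i, j); exists L => e e0.
pose c : R := (n.+1 * n.+1)%:R; have c0 : 0 < c by rewrite ltr0n.
have ed : 0 < e / (c + 1) by rewrite divr_gt0 // ltr_wpDl // ltW.
have [k hk] := choice (fun p => hl p _ ed).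
exists (\max_p k p) => m km; apply: le_lt_trans (op_norm_mx_le _) _.
apply: (@le_lt_trans _ _ (\sum_(i < n.+1) \sum_(j < n.+1) e / (c + 1))).
  apply: ler_sum => i _; apply: ler_sum => j _; rewrite op_norm_cnorm !mxE ltW //.
  by apply: (hk (i, j)); apply: leq_trans km; exact: leq_bigmax.
rewrite !sumr_const !card_ord -mulrnA -mulr_natr -/c mulrAC ltr_pdivrMr.
  by rewrite ltr_pM2l // ltrDl.
by rewrite ltr_wpDl // ltW.
Qed.

(** This makes [rep_positive], and thus the extraction of square roots, available for matrices over
    [A]. *)
HB.instance Definition _ := isCStarAlgebra.Build R M
  (@op_normD R M (mx_rep r n)) (@op_normZ R M (mx_rep r n))
  (@op_norm0_eq0 R M (mx_rep r n)) (@op_normM R M (mx_rep r n))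
  (@op_norm_star_mul R M (mx_rep r n)) mx_complete.

End MatrixCStar.

(** * Reflection of matrix positivity along injective star-homomorphisms *)

Section Pullback.
Variables (R : realType) (A D : starAlgType R) (iota : starHom A D).
Hypothesis iota_inj : injective iota.
Variable r : star_rep D.
Local Notation act a := (@rep_act _ _ r (iota a)).

Fact pull_linear v : linear (fun a => act a v).
Proof. by move=> c x y; rewrite linearP rep_actD rep_actZ. Qed.
Fact pull1 v : act 1 v = v.
Proof. by rewrite rmorph1 rep_act1. Qed.
Fact pullM x y v : act (x * y) v = act x (act y v).
Proof. by rewrite rmorphM rep_actM. Qed.
Fact pull_star x v w : rep_form (act x v) w = rep_form v (act (star x) w).
Proof. by rewrite rep_act_star -starmorph. Qed.
Fact pull_faithful x : (forall v, act x v = 0) -> x = 0.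
Proof. by move=> /rep_faithful h; apply: iota_inj; rewrite h raddf0. Qed.

Definition pull_rep : star_rep A :=
  @StarRep R A (rep_space r) (@rep_form _ _ r) (fun a => @rep_act _ _ r (iota a))
    (@rep_form_linear _ _ r) (@rep_form_conj _ _ r) (@rep_form_ge0 _ _ r)
    (@rep_form_eq0 _ _ r) pull_linear pull1 pullM pull_star
    (fun x => rep_act_bounded r (iota x)) pull_faithful.

End Pullback.

(** Through [iota], matrices over [A] act on a direct power of [r], where [X] acts positively
    because its image is a product [star_mx Y *m Y]. By [rep_positive] in the matrix C*-algebra over
    [A], [X] has a square root with entries in [A] itself. *)
Lemma mx_positive_reflect (R : realType) (A : cstarAlgType R) (D : starAlgType R)
    (iota : starHom A D) (r : star_rep D) n (X : 'M[A]_n) :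
  injective iota -> mx_positive (map_mx iota X) -> mx_positive X.
Proof.
move=> inj; case: n X => [|n] X [Y XY].
  (* Empty matrices are treated apart, [matrix_alg n] having size [n.+1]. *)
  by exists X; apply/matrixP => [[]].
have sX : star_mx X = X.
  apply/matrixP => i j; apply: inj; rewrite mxE starmorph.
  have XE k l : iota (X k l) = \sum_m star (Y m k) * Y m l.
    by move/matrixP/(_ k l): XY; rewrite !mxE => ->; apply: eq_bigr => m _; rewrite mxE.
  rewrite !XE star_sum; apply: eq_bigr => m _.
  by rewrite starM starK.
pose rA := pull_rep inj r; pose Y' : matrix_alg n r := Y.
have [|v|c [sc cE _]] := @rep_positive _ _ (mx_rep rA n) (X : matrix_alg n rA).
- exact: sX.
- have -> : rep_form (rep_act (X : matrix_alg n rA) v) v =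
      rep_form (rep_act (star Y' * Y') (v : rep_space (mx_rep r n))) v.
    apply: eq_bigr => i _; congr (rep_form _ _); rewrite !ffunE.
    apply: eq_bigr => j _; move/matrixP/(_ i j): XY; rewrite mxE => XYij.
    by rewrite -[LHS]/(@rep_act _ _ r (iota (X i j)) (v j)) XYij.
  by rewrite rep_form_sqr rep_form_ge0.
by exists c; rewrite [star_mx c]sc.
Qed.

(** * States, multiplicative domains and local states *)

Section StateTheory.
Variables (R : realType) (A : starAlgType R) (f : A -> R[i]).
Hypothesis fs : is_state f.
Local Notation Re := complex.Re.
Local Notation normc := ComplexField.Normc.normc.
Implicit Types (x y z : A).

Lemma stateD x y : f (x + y) = f x + f y.
Proof. by have := state_linear fs 1 x y; rewrite scale1r mul1r. Qed.

Lemma state0 : f 0 = 0.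
Proof. by apply: (addrI (f 0)); rewrite -stateD !addr0. Qed.

Lemma stateZ c x : f (c *: x) = c * f x.
Proof. by rewrite -[c *: x]addr0 (state_linear fs) state0 addr0. Qed.

Lemma stateB x y : f (x - y) = f x - f y.
Proof. by rewrite stateD -scaleN1r stateZ mulN1r. Qed.

Lemma state_sum I (s : seq I) P (F : I -> A) :
  f (\sum_(i <- s | P i) F i) = \sum_(i <- s | P i) f (F i).
Proof. exact: (big_morph f stateD state0). Qed.

Lemma state_CS x y :
  normc (f (star y * x)) ^+ 2 <= Re (f (star x * x)) * Re (f (star y * y)).
Proof.
apply: (@form_CS _ _ (fun x y => f (star y * x))).
- by move=> w c u v; rewrite mulrDr -scalerAr stateD stateZ.
- by move=> u v w; rewrite starD mulrDl stateD.
- by move=> c u v; rewrite starZ -scalerAl stateZ.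
- by move=> v; exact: state_ge0.
Qed.

(** By Cauchy-Schwarz, a vector of length zero for the form of [f] is orthogonal to all others. *)
Lemma state_null x y : f (star x * x) = 0 -> f (star x * y) = 0 /\ f (star y * x) = 0.
Proof.
move=> x0; have null (c : R[i]) : normc c ^+ 2 <= 0 -> c = 0.
  move=> h; apply: ComplexField.Normc.eq0_normc; apply/eqP.
  by rewrite -sqrf_eq0 eq_le h sqr_ge0.
by split; apply: null; apply: le_trans (state_CS _ _) _; rewrite x0 ?mulr0 ?mul0r.
Qed.

End StateTheory.

(** Cauchy-Schwarz against 1 bounds the squared modulus of [f x] by [f (star x * x)], and [f] is
    nonnegative on the square [s * s] of [norm_defect]. The bound is the same for all states, as
    limits of states require. *)
Lemma state_norm_le (R : realType) (A : cstarAlgType R) (f : A -> R[i]) (x : A) :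
  is_state f -> ComplexField.Normc.normc (f x) <= cnorm x.
Proof.
move=> fs; rewrite -(@ler_pXn2r _ 2) ?nnegrE ?normc_nonneg ?cnorm_ge0 //.
have := state_CS fs x 1; rewrite star1 !mul1r (state1 fs) mulr1 => h.
apply: le_trans h _; have [s ss sE] := norm_defect (lexx (cnorm x)).
have := ge0_Re (state_ge0 fs s); rewrite ss sE (stateB fs) (stateZ fs) (state1 fs).
by rewrite mulr1 ReB subr_ge0.
Qed.

Lemma mx_positive_map (R : realType) (A B : starAlgType R) (h : starHom A B) n
    (X : 'M[A]_n) : mx_positive X -> mx_positive (map_mx h X).
Proof.
case=> Y ->; exists (map_mx h Y); apply/matrixP => i j.
rewrite !mxE rmorph_sum; apply: eq_bigr => k _.
by rewrite !mxE rmorphM -starmorph.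
Qed.

(** The factor has [t] as its row 0 and zeros elsewhere. *)
Lemma gram_positive (R : realType) (A : starAlgType R) n (t : 'I_n.+1 -> A) :
  mx_positive (\matrix_(i, j) (star (t i) * t j)).
Proof.
exists (\matrix_(k, j) if k == 0 then t j else 0); apply/matrixP => i j.
rewrite !mxE (bigD1 0) //= big1 => [|k k0]; first by rewrite !mxE eqxx addr0.
by rewrite !mxE (negbTE k0) mulr0.
Qed.

(* The Gram matrix of (1, a, x) is mapped by Phi to a Gram matrix star W * W, whose
   columns satisfy <v, v> = 0 for v := W 1 - W 0 * Phi a. By Cauchy-Schwarz for tr,
   v is orthogonal to the column W 2. *)
Section MultiplicativeDomain.
Variables (R : realType) (D Q : starAlgType R) (Phi : D -> Q) (tr : Q -> R[i]).
Hypothesis tr_state : is_state tr.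
Hypothesis Phi1 : Phi 1 = 1.
Hypothesis Phi_pos : forall n (X : 'M[D]_n), mx_positive X -> mx_positive (map_mx Phi X).
Variable a : D.
Hypothesis Phi_star : Phi (star a) = star (Phi a).
Hypothesis Phi_sq : Phi (star a * a) = star (Phi a) * Phi a.

Let key x : tr (Phi (star a * x)) = tr (star (Phi a) * Phi x) /\
  tr (Phi (star x * a)) = tr (Phi (star x) * Phi a).
Proof.
pose t (i : 'I_3) := nth 0 [:: 1; a; x] i.
have [W WE] := Phi_pos (gram_positive t).
pose o0 : 'I_3 := @Ordinal 3 0 isT; pose o1 : 'I_3 := @Ordinal 3 1 isT.
pose o2 : 'I_3 := @Ordinal 3 2 isT.
have PE i j : \sum_k star (W k i) * W k j = Phi (star (t i) * t j).
  move/matrixP/(_ i j): WE; rewrite !mxE => ->.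
  by apply: eq_bigr => k _; rewrite mxE.
pose v k := W k o1 - W k o0 * Phi a.
have vW j : \sum_k star (v k) * W k j = Phi (star a * t j) - star (Phi a) * Phi (t j).
  rewrite -(PE o1) -[t j]mul1r -star1 -(PE o0) mulr_sumr -sumrB; apply: eq_bigr => k _.
  by rewrite starD starN starM mulrBl mulrA.
have Wv j : \sum_k star (W k j) * v k = Phi (star (t j) * a) - Phi (star (t j)) * Phi a.
  rewrite -(PE _ o1) -[star (t j)]mulr1 -(PE _ o0) mulr_suml -sumrB.
  by apply: eq_bigr => k _; rewrite mulrBr mulrA.
(* After expansion of the right factor, the term from column 1 vanishes by [Phi_sq] and the one from
   column 0 by [Phi_star] and [Phi1]. *)
have vv : \sum_k star (v k) * v k = 0.
  under eq_bigr do rewrite {2}/v mulrBr mulrA.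
  rewrite sumrB -mulr_suml !vW /= Phi_sq subrr mulr1 Phi_star Phi1 mulr1 subrr mul0r.
  by rewrite subrr.
(* [Q] is only a star-algebra, so the vanishing of the sum is exploited through [tr], whose values
   on the summands are nonnegative. *)
have v0 k : tr (star (v k) * v k) = 0.
  move/(congr1 tr): vv; rewrite (state_sum tr_state) (state0 tr_state).
  move=> /psumr_eq0P h; apply: h => // i _; exact: state_ge0 tr_state _.
split; apply/eqP; rewrite -subr_eq0 -(stateB tr_state).
  rewrite -(vW o2) (state_sum tr_state) big1 // => k _.
  by case: (state_null tr_state (W k o2) (v0 k)).
rewrite -(Wv o2) (state_sum tr_state) big1 // => k _.
by case: (state_null tr_state (W k o2) (v0 k)).
Qed.

Lemma multiplicative_domain_l x : tr (Phi (star a * x)) = tr (star (Phi a) * Phi x).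
Proof. by case: (key x). Qed.

Lemma multiplicative_domain_r x : tr (Phi (x * a)) = tr (Phi x * Phi a).
Proof. by case: (key (star x)); rewrite starK. Qed.

End MultiplicativeDomain.

(** * Finite-dimensional operator systems generated by finite sets *)

Section Span.
Variables (R : realType) (A : starAlgType R).
Implicit Types (L : seq A) (x y : A).

Definition span_of L : set A := [set x |
  exists c : 'I_(size L) -> R[i], x = \sum_i c i *: L`_i]%classic.

Lemma span_finite L : finite_dimensional (span_of L).
Proof. by exists (size L), (fun i => L`_i). Qed.

Lemma span_mem L x : x \in L -> span_of L x.
Proof.
move=> xL; have iL : (index x L < size L)%N by rewrite index_mem.
exists (fun i => (i == Ordinal iL)%:R); rewrite (bigD1 (Ordinal iL)) //= eqxx.
rewrite scale1r nth_index // big1 ?addr0 // => i /negbTE ->.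
by rewrite scale0r.
Qed.

Lemma span_linear L c x y : span_of L x -> span_of L y -> span_of L (c *: x + y).
Proof.
move=> [a ->] [b ->]; exists (fun i => c * a i + b i).
rewrite scaler_sumr -big_split; apply: eq_bigr => i _ /=.
by rewrite scalerDl scalerA.
Qed.

Lemma span_star L x : (forall y, y \in L -> star y \in L) -> span_of L x -> span_of L (star x).
Proof.
move=> sL [c ->]; rewrite star_sum; elim/big_rec: _ => [|i y _ yL].
  by exists (fun _ => 0); rewrite big1 // => i _; rewrite scale0r.
by rewrite starZ; apply: span_linear => //; apply/span_mem/sL/mem_nth.
Qed.

(** The products [star a * a] and [a * star a] are included so that a lift on the span puts both [a]
    and [star a] in the multiplicative domain. *)
Definition star_closure (s : seq A) : seq A :=
  1 :: flatten [seq [:: a; star a; star a * a; a * star a] | a <- s].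

Lemma star_closure_star s y : y \in star_closure s -> star y \in star_closure s.
Proof.
rewrite !inE => /orP[/eqP ->|]; first by rewrite star1 eqxx.
case/flatten_mapP => a sa ya; apply/orP; right; apply/flatten_mapP; exists a => //.
move: ya; rewrite !inE => /or4P[] /eqP ->; rewrite ?starM ?starK eqxx ?orbT //.
Qed.

Lemma star_closure_sub s a : a \in s ->
  [/\ a \in star_closure s, star a \in star_closure s,
      star a * a \in star_closure s & a * star a \in star_closure s].
Proof.
move=> sa; split; rewrite inE; apply/orP; right; apply/flatten_mapP; exists a;
  by rewrite // !inE eqxx ?orbT.
Qed.

Lemma span_opsys s : operator_system (span_of (star_closure s)).
Proof.
split=> [||x]; first by apply: span_mem; rewrite inE eqxx.
  by move=> c x y; exact: span_linear.
exact/span_star/star_closure_star.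
Qed.

End Span.

Section LocalStates.
Variables (R : realType) (B : cstarAlgType R) (J : proper_closed_ideal B).
Variables (A : cstarAlgType R) (pi : starHom A (quotient_alg J)).
Variables (tr : quotient_alg J -> R[i]) (H : hilbertType R).
Variable iota : starHom A (bounded_operator H).
Hypothesis B_inj : injective_cstar B.
Hypothesis tr_tracial : tracial_state tr.
Hypothesis iota_inj : injective iota.
Hypothesis pi_LLP : LLP pi.

Lemma local_amenable_state (s : seq A) : exists rho : bounded_operator H -> R[i],
  [/\ is_state rho, forall a, a \in s -> rho (iota a) = tr (pi a) &
      forall a T, a \in s -> rho (iota a * T) = rho (T * iota a)].
Proof.
pose T := span_of (star_closure s); have T_os : operator_system T by exact: span_opsys.
have [psi psi_ucp psi_lift] := pi_LLP T_os (span_finite _).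
pose S1 : set (bounded_operator H) := [set y | exists2 x, T x & iota x = y]%classic.
have S1_os : operator_system S1.
  split; first by exists 1; [exact: opsys1 T_os|rewrite rmorph1].
    move=> c _ _ [x Tx <-] [y Ty <-]; exists (c *: x + y); last by rewrite linearP.
    exact: opsys_linear.
  by move=> _ [x Tx <-]; exists (star x); [exact: opsys_star|rewrite starmorph].
have setT_os : @operator_system R (bounded_operator H) [set: _]%classic by [].
(* A left inverse of [iota]; the default value 0 is taken only outside its range. *)
pose inv y := xget 0 [set x | iota x = y]%classic.
have invK x : inv (iota x) = x.
  apply: iota_inj.
  have := @xgetPex _ 0 [set z | iota z = iota x]%classic; apply.
  by exists x.
pose phi y := psi (inv y).
have phi_ucp : ucp_on S1 phi.
  split.
  - move=> c _ _ [x Tx <-] [y Ty <-].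
    by rewrite -linearP /phi !invK; exact: ucp_linear psi_ucp _ _ _ Tx Ty.
  - by rewrite -(rmorph1 iota) /phi invK; exact: ucp1 psi_ucp.
  - move=> n X S1X Xpos; pose Y := map_mx inv X.
    have XE : X = map_mx iota Y.
      apply/matrixP => i j; rewrite !mxE.
      by have [x _ <-] := S1X i j; rewrite invK.
    have -> : map_mx phi X = map_mx psi Y by apply/matrixP => i j; rewrite !mxE.
    apply: (ucp_positive psi_ucp) => [i j|].
      by rewrite mxE; have [x Tx <-] := S1X i j; rewrite invK.
    (* [X] is known to be positive over B(H) only, whereas [psi] needs positivity over [A]. *)
    by apply: (mx_positive_reflect (bop_rep H) iota_inj); rewrite -XE.
have [Psi Psi_ucp PsiE] := B_inj S1_os setT_os (fun _ _ => I) phi_ucp.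
pose Phi y := quotient_proj J (Psi y).
have Phi_iota x : T x -> Phi (iota x) = pi x.
  move=> Tx; rewrite /Phi PsiE; last by exists x.
  by rewrite /phi invK psi_lift.
have Phi1 : Phi 1 = 1 by rewrite /Phi (ucp1 Psi_ucp) rmorph1.
have Phi_lin : linear Phi.
  by move=> c x y; rewrite /Phi (ucp_linear Psi_ucp) // linearP.
have Phi_pos n (X : 'M_n) : mx_positive X -> mx_positive (map_mx Phi X).
  move=> Xpos; have := ucp_positive Psi_ucp (fun _ _ => I) Xpos.
  move=> /(mx_positive_map (quotient_proj J)); congr mx_positive.
  by apply/matrixP => i j; rewrite !mxE.
have tr_state := tracial_is_state tr_tracial.
exists (fun y => tr (Phi y)); split.
- split.
  + by move=> c x y; rewrite Phi_lin (stateD tr_state) (stateZ tr_state).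
  + move=> x; have [Y /matrixP/(_ 0 0)] := Phi_pos _ _ (gram_positive (fun _ : 'I_1 => x)).
    by rewrite !mxE big_ord1 mxE => ->; exact: state_ge0.
  + by rewrite Phi1 (state1 tr_state).
- by move=> a /star_closure_sub[/span_mem/Phi_iota ->].
- move=> a X /star_closure_sub[/span_mem h1 /span_mem h2 /span_mem h3 /span_mem h4].
  have pi_star x : pi (star x) = star (pi x) by rewrite starmorph.
  have iota_star x : star (iota x) = iota (star x) by rewrite starmorph.
  have piM x y : pi (x * y) = pi x * pi y by rewrite rmorphM.
  have iotaM x y : iota x * iota y = iota (x * y) by rewrite rmorphM.
  (* Left multiplication by [iota a] is handled by the multiplicative domain at [iota (star a)],
     which uses [a * star a]; right multiplication by the one at [iota a], which uses [star a * a].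
     Traciality of [tr] then exchanges the factors. *)
  have iotaE : iota a = star (iota (star a)) by rewrite iota_star starK.
  rewrite {1}iotaE (multiplicative_domain_l tr_state Phi1 Phi_pos); first last.
  + by rewrite iota_star iotaM starK !Phi_iota // piM pi_star starK.
  + by rewrite iota_star starK !Phi_iota // pi_star starK.
  rewrite (multiplicative_domain_r tr_state Phi1 Phi_pos); first last.
  + by rewrite iota_star iotaM !Phi_iota // piM pi_star.
  + by rewrite iota_star !Phi_iota // pi_star.
  by rewrite (tracialC tr_tracial) !Phi_iota // pi_star starK.
Qed.

End LocalStates.

(** * Limits along ultrafilters *)

Section UltraLimits.
Local Open Scope classical_set_scope.
Variables (R : realType) (T : Type) (U : set_system T).
Hypothesis U_ultra : UltraFilter U.

(** Compactness of the segment gives a cluster point. It is a limit: if the preimage of a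
    neighbourhood were not in [U], its complement would be. *)
Lemma ultra_lim_exists (g : T -> R) (M : R) :
  (forall t, `|g t| <= M) -> exists l : R, g @ U --> l.
Proof.
move=> gM.
have cpt : compact (`[- M, M] : set R) by exact: segment_compact.
have [|l [_ cl]] := cpt (g @ U) _.
  by apply: (@filterE _ U) => t; rewrite /= in_itv /= -ler_norml gM.
exists l => V lV; have [//|UV] := in_ultra_setVsetC (g @^-1` V) U_ultra.
by have [x [] ] := cl (~` V) V UV lV.
Qed.

Lemma ultra_lim_unique (g h : T -> R) (l l' : R) :
  U [set t | g t = h t] -> g @ U --> l -> h @ U --> l' -> l = l'.
Proof.
move=> gh gl hl; have gl' : g @ U --> l'.
  apply: cvg_trans hl; apply: near_eq_cvg.
  by apply: filterS gh => t /= ->.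
exact: cvg_unique _ gl gl'.
Qed.

Definition ultra_lim (g : T -> R[i]) (l : R[i]) :=
  (fun t => complex.Re (g t)) @ U --> complex.Re l /\
  (fun t => complex.Im (g t)) @ U --> complex.Im l.

Lemma ultra_lim_bounded (g : T -> R[i]) (M : R) :
  (forall t, ComplexField.Normc.normc (g t) <= M) -> exists l, ultra_lim g l.
Proof.
move=> gM.
have [|a ga] := @ultra_lim_exists (fun t => complex.Re (g t)) M.
  by move=> t; apply: le_trans (le_Re_normc _) (gM t).
have [|b gb] := @ultra_lim_exists (fun t => complex.Im (g t)) M.
  by move=> t; apply: le_trans (le_Im_normc _) (gM t).
by exists (Complex a b).
Qed.

Lemma ultra_lim_eq (g h : T -> R[i]) l l' :
  U [set t | g t = h t] -> ultra_lim g l -> ultra_lim h l' -> l = l'.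
Proof.
move=> gh [gr gi] [hr hi]; apply/eqP; rewrite eq_complex.
apply/andP; split; apply/eqP.
  by apply: ultra_lim_unique gr hr; apply: filterS gh => t /= ->.
by apply: ultra_lim_unique gi hi; apply: filterS gh => t /= ->.
Qed.

Lemma ultra_lim_cst (c : R[i]) : ultra_lim (fun _ => c) c.
Proof. by split; exact: cvg_cst. Qed.

Lemma ultra_lim_linear (c : R[i]) (g h : T -> R[i]) l l' :
  ultra_lim g l -> ultra_lim h l' -> ultra_lim (fun t => c * g t + h t) (c * l + l').
Proof.
move=> [gr gi] [hr hi]; split.
  rewrite ReD ReM; under eq_fun do rewrite ReD ReM.
  by apply: cvgD => //; apply: cvgB; apply: cvgM => //; exact: cvg_cst.
rewrite ImD ImM; under eq_fun do rewrite ImD ImM.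
by apply: cvgD => //; apply: cvgD; apply: cvgM => //; exact: cvg_cst.
Qed.

Lemma ultra_lim_ge0 (g : T -> R[i]) l : (forall t, 0 <= g t) -> ultra_lim g l -> 0 <= l.
Proof.
move=> g0 [gr gi]; rewrite lecE; apply/andP; split.
  apply/eqP; apply: ultra_lim_unique gi (cvg_cst 0).
  by apply: filterE => t /=; have := g0 t; rewrite lecE => /andP[/eqP].
(* The real parts equal their absolute values, and so does their limit by continuity. *)
have -> : complex.Re l = `|complex.Re l|.
  apply: ultra_lim_unique gr (cvg_norm gr).
  by apply: filterE => t /=; rewrite ger0_norm // ge0_Re.
exact: normr_ge0.
Qed.

End UltraLimits.

(** Lists stand for finite subsets. The sets of lists containing a given one form a filter base,
    directed through concatenation, and an ultrafilter refines it. *)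
Lemma superset_ultrafilter (T : eqType) : exists U : set_system (seq T),
  UltraFilter U /\ forall a : T, U [set s : seq T | a \in s]%classic.
Proof.
pose F := filter_from [set: seq T]%classic
  (fun s0 => [set s : seq T | {subset s0 <= s}]%classic).
have FF : ProperFilter F.
  apply: filter_from_proper; last by move=> s _; exists s => x.
  apply: filter_from_filter; first by exists [::].
  move=> s1 s2 _ _; exists (s1 ++ s2) => // s sub.
  by split=> x xs; apply: sub; rewrite mem_cat xs ?orbT.
have [U [UU FU]] := ultraFilterLemma FF; exists U; split=> // a.
apply: FU; exists [:: a] => // s sub /=.
by apply: sub; rewrite inE.
Qed.

Lemma tracial_state_comp (R : realType) (A Q : starAlgType R) (pi : starHom A Q)
    (tr : Q -> R[i]) : tracial_state tr -> tracial_state (fun a => tr (pi a)).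
Proof.
move=> [trs trC]; split; last by move=> x y; rewrite !rmorphM trC.
split=> [c x y|x|]; first by rewrite linearP (stateD trs) (stateZ trs).
  by rewrite rmorphM [X in X * _]starmorph; exact: state_ge0 trs _.
by rewrite rmorph1 (state1 trs).
Qed.

Theorem theorem4p3 (R : realType) (B : cstarAlgType R)
    (J : proper_closed_ideal B) (A : cstarAlgType R) :
  injective_cstar B ->
  (exists tau : quotient_alg J -> R[i], tracial_state tau) ->
  (forall tau : A -> R[i], ~ amenable_trace tau) ->
  forall pi : starHom A (quotient_alg J), ~ LLP pi.
Proof.
move=> B_inj [tr tr_tracial] no_amenable pi pi_LLP.
apply: (no_amenable (fun a => tr (pi a))); split; first exact: tracial_state_comp.
move=> H iota iota_inj.
have [rho rhoP] :=
  choice (local_amenable_state B_inj tr_tracial iota_inj pi_LLP).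
have [U [U_ultra U_mem]] := superset_ultrafilter A.
(* Pointwise limits exist because the values at [T] are bounded by [cnorm T] uniformly in [s]. *)
have ex T : exists l, ultra_lim U (fun s => rho s T) l.
  apply: (ultra_lim_bounded U_ultra (M := cnorm T)) => s.
  by have [rs _ _] := rhoP s; exact: state_norm_le.
have [f fP] := choice ex; exists f; split.
- split=> [c S T|T|].
  + apply: (ultra_lim_eq U_ultra _ (fP _) (ultra_lim_linear U_ultra c (fP S) (fP T))).
    apply: filterE => s /=; have [rs _ _] := rhoP s.
    by rewrite (stateD rs) (stateZ rs).
  + by apply: (ultra_lim_ge0 U_ultra _ (fP _)) => s; have [[]] := rhoP s.
  + apply: (ultra_lim_eq U_ultra _ (fP _) (ultra_lim_cst _ 1)).
    by apply: filterE => s /=; have [[]] := rhoP s.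
(* The identities for [a] hold at every [s] containing [a], and these form a member of [U]. *)
- move=> a; apply: (ultra_lim_eq U_ultra _ (fP _) (ultra_lim_cst _ _)).
  by apply: filterS (U_mem a) => s /= sa; have [_ -> //] := rhoP s.
- move=> a T; apply: (ultra_lim_eq U_ultra _ (fP _) (fP _)).
  by apply: filterS (U_mem a) => s /= sa; have [_ _ ->] := rhoP s.
Qed.
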